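(* Let $\mathfrak{R}$ be a regular polynomially bounded structure with field of exponents $\Lambda$. Let $V \subset (\mathbb{R}_{>0})^n$ be a set that is definable in $\mathfrak{R}$. Denote by $\overline{V}$ the extension of $V$ to $H(\mathfrak{R})$ and by $\overline{\overline{V}}$ the extension of $V$ to $H(\mathfrak{R}^{\mathbb{R}})$. Then $$\mathcal{A}_0(V) = \mathrm{Log}(\overline{\overline{V}}).$$ Moreover the subset $\mathcal{A}_0(V) \cap \Lambda^n$ is dense in $\mathcal{A}_0(V)$, and $$\mathcal{A}(\overline{V}) = \mathcal{A}(\overline{\overline{V}}) = \mathrm{Log}(\overline{\overline{V}}).$$
   Context: Structures: $\overline{\mathbb{R}}$ denotes the ordered real field $(\mathbb{R},\le,+,\cdot)$. All structures considered are first-order structures $\mathfrak{R}$ on $\mathbb{R}$ expanding $\overline{\mathbb{R}}$; ''definable'' means definable by a first-order formula with parameters. $\mathfrak{R}$ is polynomially bounded if every definable $f:\mathbb{R}\to\mathbb{R}$ is ultimately bounded in absolute value by some power $x^N$. For $\mathfrak{R}$ o-minimal and polynomially bounded, every definable $f:\mathbb{R}\to\mathbb{R}$ not ultimately $0$ satisfies $\lim_{x\to+\infty}f(x)/x^r=c$ for some $r,c\in\mathbb{R}$, $c\neq0$; the set of all such $r$ is a subfield of $\mathbb{R}$, the field of exponents of $\mathfrak{R}$. $\mathfrak{R}^{\mathbb{R}}$ denotes the expansion of $\mathfrak{R}$ by all real power functions, i.e. for each $\lambda\in\mathbb{R}$ the function equal to $x^\lambda$ for $x>0$ and $0$ for $x\le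 0$. A regular polynomially bounded structure is an o-minimal, polynomially bounded expansion $\mathfrak{R}$ of $\overline{\mathbb{R}}$ such that $\mathfrak{R}^{\mathbb{R}}$ is polynomially bounded. Logarithmic limit set: for $V\subset(\mathbb{R}_{>0})^n$ and $t\in(0,1)$ let $\mathrm{Log}_{1/t}(x_1,\dots,x_n)=(\log_{1/t}x_1,\dots,\log_{1/t}x_n)$ and $\mathcal{A}_t(V)=\mathrm{Log}_{1/t}(V)\subset\mathbb{R}^n$. For a family $(S_t)_{t\in(0,\varepsilon)}$ of subsets of $\mathbb{R}^n$, $\lim_{t\to0}S_t$ is the set of $y\in\mathbb{R}^n$ such that $(y,0)$ lies in the closure of $\{(x,t): x\in S_t\}$ in $\mathbb{R}^n\times[0,\varepsilon)$. Then $\mathcal{A}_0(V)=\lim_{t\to0}\mathcal{A}_t(V)$. Hardy field: for an o-minimal $\mathfrak{R}$, $H(\mathfrak{R})$ is the set of germs at $0^+$ of definable functions $f:\mathbb{R}_{>0}\to\mathbb{R}$. It contains $\mathbb{R}$ (constants), is a real closed field, and carries a structure in the same language such that a formula holds of germs $[f_1],\dots,[f_k]$ iff it holds in $\mathfrak{R}$ of $f_1(t),\dots,f_k(t)$ for all sufficiently small $t>0$; it is an elementary extension of $\mathfrak{R}$. When $\mathfrak{R}$ is polynomially bounded, $H(\mathfrak{R})$ has the valuation $v$ with $v([f])=r$ where $\lim_{x\to0^+}f(x)/x^r=c\ne0$. For a definable $V\subset\mathbb{R}^n$, its extension to an elementary extension is the set defined there by a formula (with real parameters) defining $V$. For $W\subset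 (F_{>0})^n$, with $F$ a real closed valued field with real-valued valuation $v$, $\mathrm{Log}(W)=\{(-v(h_1),\dots,-v(h_n)):h\in W\}\subset\mathbb{R}^n$ and the non-archimedean amoeba $\mathcal{A}(W)$ is the closure of $\mathrm{Log}(W)$ in $\mathbb{R}^n$. *)

(* Defs.v *)
From HB Require Import structures.
From mathcomp Require Import all_boot all_order all_algebra.
From mathcomp Require Import all_classical all_reals all_analysis.
Set Implicit Arguments.
Unset Strict Implicit.
Unset Printing Implicit Defensive.
Import Order.TTheory GRing.Theory Num.Theory.
Import numFieldNormedType.Exports.
Local Open Scope classical_set_scope.
Local Open Scope quotient_scope.
Local Open Scope ring_scope.

Record language := Language {
  fsym : Type;
  farity : fsym -> nat;
  rsym : Type;
  rarity : rsym -> nat }.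

Record structure (L : language) (A : Type) := Structure {
  fint : forall f : fsym L, ('I_(farity f) -> A) -> A;
  rint : forall r : rsym L, ('I_(rarity r) -> A) -> Prop }.

Definition language_join (L1 L2 : language) : language :=
  @Language (fsym L1 + fsym L2)
    (fun f => match f with inl g => farity g | inr g => farity g end)
    (rsym L1 + rsym L2)
    (fun r => match r with inl s => rarity s | inr s => rarity s end).

Definition structure_join (L1 L2 : language) (A : Type)
    (M1 : structure L1 A) (M2 : structure L2 A) :
    structure (language_join L1 L2) A :=
  @Structure (language_join L1 L2) A
    (fun f => match f return ('I_(@farity (language_join L1 L2) f) -> A) -> A
              with inl g => @fint _ _ M1 g | inr g => @fint _ _ M2 g end)
    (fun r => match r return ('I_(@rarity (language_join L1 L2) r) -> A) -> Prop
              with inl s => @rint _ _ M1 s | inr s => @rint _ _ M2 s end).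

(* Terms and formulas in the free variables 'I_n, with parameters in P. A
   quantifier binds the variable 0. The other connectives and the universal
   quantifier are the usual (classical) abbreviations. *)
Inductive term (L : language) (P : Type) (n : nat) : Type :=
| Var of 'I_n
| Par of P
| App (f : fsym L) of ('I_(farity f) -> term L P n).

Inductive formula (L : language) (P : Type) : nat -> Type :=
| Eq n of term L P n & term L P n : formula L P n
| Rel n (r : rsym L) of ('I_(rarity r) -> term L P n) : formula L P n
| Not n of formula L P n : formula L P n
| And n of formula L P n & formula L P n : formula L P n
| Ex n of formula L P n.+1 : formula L P n.

Arguments Var {L P n}.
Arguments Par {L P n}.
Arguments App {L P n}.
Arguments Eq {L P n}.
Arguments Rel {L P n}.
Arguments Not {L P n}.
Arguments And {L P n}.
Arguments Ex {L P n}.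

Definition env_cons (A : Type) (n : nat) (a : A) (e : 'I_n -> A) :
    'I_n.+1 -> A :=
  fun i => if unlift ord0 i is Some j then e j else a.

Section Semantics.
Variables (L : language) (P A : Type) (M : structure L A) (j : P -> A).

Fixpoint eval n (e : 'I_n -> A) (t : term L P n) : A :=
  match t with
  | Var i => e i
  | Par p => j p
  | App f u => fint M (fun i => eval e (u i))
  end.

Fixpoint sat n (phi : formula L P n) : ('I_n -> A) -> Prop :=
  match phi in formula _ _ k return ('I_k -> A) -> Prop with
  | Eq _ t u => fun e => eval e t = eval e u
  | Rel _ r u => fun e => rint M (fun i => eval e (u i))
  | Not _ psi => fun e => ~ sat psi e
  | And _ psi chi => fun e => sat psi e /\ sat chi e
  | Ex _ psi => fun e => exists a, sat psi (env_cons a e)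
  end.

Definition defined_set n (phi : formula L P n) : set 'rV[A]_n :=
  [set x | sat phi (x ord0)].

End Semantics.

(* The extension of V from M to N, where j : A -> B is an elementary embedding:
   as j is elementary, all the formulas that define V in M define the same
   set in N. *)
Definition extension (L : language) (A B : Type) (M : structure L A)
    (N : structure L B) (j : A -> B) n (V : set 'rV[A]_n) : set 'rV[B]_n :=
  [set h | exists2 phi : formula L A n,
     defined_set M id phi = V & defined_set N j phi h].

Inductive field_fsym := AddSym | MulSym.
Inductive field_rsym := LeSym.

Definition ordered_field_language : language :=
  @Language field_fsym (fun=> 2%N) field_rsym (fun=> 2%N).

Definition real_field (R : realType) : structure ordered_field_language R :=
  @Structure ordered_field_language R
    (fun f => match f with
              | AddSym => fun x => x ord0 + x ord_max
              | MulSym => fun x => x ord0 * x ord_max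
              end)
    (fun=> fun x => x ord0 <= x ord_max).

(* From here on, an expansion of the real field is given by its additional
   structure M : structure L R; the expansion itself is [over_field M]. *)
Notation field_language L := (language_join ordered_field_language L).

Definition over_field (R : realType) (L : language) (M : structure L R) :
    structure (field_language L) R :=
  structure_join (real_field R) M.

Section Expansions.
Variables (R : realType) (L : language) (M : structure L R).

Definition definable n (V : set 'rV[R]_n) : Prop :=
  exists phi : formula (field_language L) R n,
    defined_set (over_field M) id phi = V.

Definition definable_subset (A : set R) : Prop :=
  definable [set x : 'rV[R]_1 | A (x ord0 ord0)].

Definition definable_fun (f : R -> R) : Prop :=
  definable [set x : 'rV[R]_2 | x ord0 ord_max = f (x ord0 ord0)].

Definition o_minimal : Prop :=
  forall A : set R, definable_subset A ->
    exists s : seq (interval R), A = \big[setU/set0]_(I <- s) [set` I].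

Definition polynomially_bounded : Prop :=
  forall f : R -> R, definable_fun f ->
    exists N : nat, \forall x \near +oo, `|f x| <= x ^+ N.

Definition field_of_exponents : set R :=
  [set r | exists2 f : R -> R, definable_fun f &
     exists2 c : R, c != 0 & (fun x => f x / x `^ r) @ +oo --> c].

End Expansions.

Definition power_language (R : realType) : language :=
  @Language R (fun=> 1%N) False (fun=> 0%N).

Definition power_functions (R : realType) : structure (power_language R) R :=
  @Structure (power_language R) R
    (fun (lambda : R) x => if 0 < x ord0 then x ord0 `^ lambda else 0)
    (fun _ _ => False).

Definition power_expansion (R : realType) (L : language) (M : structure L R) :
    structure (language_join L (power_language R)) R :=
  structure_join M (power_functions R).

Definition regular (R : realType) (L : language) (M : structure L R) : Prop :=
  [/\ o_minimal M, polynomially_bounded M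
    & polynomially_bounded (power_expansion M)].

Lemma regular_o_minimal (R : realType) (L : language) (M : structure L R) :
  regular M -> o_minimal M.
Proof. by case. Qed.

Section Substitution.
Variables (L : language) (P A : Type) (M : structure L A) (j : P -> A).

Fixpoint term_rename n m (s : 'I_n -> 'I_m) (t : term L P n) : term L P m :=
  match t with
  | Var i => Var (s i)
  | Par p => Par p
  | App f u => App f (fun i => term_rename s (u i))
  end.

Definition rename_lift n m (s : 'I_n -> 'I_m) : 'I_n.+1 -> 'I_m.+1 :=
  env_cons ord0 (fun i => lift ord0 (s i)).

Fixpoint rename n (phi : formula L P n) : forall m, ('I_n -> 'I_m) -> formula L P m :=
  match phi in formula _ _ k return forall m, ('I_k -> 'I_m) -> formula L P m with
  | Eq _ t u => fun m s => Eq (term_rename s t) (term_rename s u)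
  | Rel _ r u => fun m s => Rel r (fun i => term_rename s (u i))
  | Not _ psi => fun m s => Not (rename psi s)
  | And _ psi chi => fun m s => And (rename psi s) (rename chi s)
  | Ex _ psi => fun m s => Ex (rename psi (rename_lift s))
  end.

Lemma eval_rename n m (s : 'I_n -> 'I_m) (e : 'I_m -> A) (t : term L P n) :
  eval M j e (term_rename s t) = eval M j (e \o s) t.
Proof.
elim: t => //= f u IH; congr (fint _); apply: funext => i; exact: IH.
Qed.

Lemma env_cons_rename n m (s : 'I_n -> 'I_m) a (e : 'I_m -> A) :
  env_cons a e \o rename_lift s = env_cons a (e \o s).
Proof.
apply: funext => i; rewrite /= /rename_lift /env_cons.
by case: (unliftP ord0 i) => [k|] _; rewrite ?liftK ?unlift_none.
Qed.

Lemma sat_rename n (phi : formula L P n) m (s : 'I_n -> 'I_m) (e : 'I_m -> A) :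
  sat M j (rename phi s) e <-> sat M j phi (e \o s).
Proof.
elim: phi m s e => {n} /=.
- by move=> n t u m s e; rewrite /= !eval_rename.
- move=> n r u m s e; rewrite (_ : (fun i => _) = fun i => eval M j (e \o s) (u i))//.
  by apply: funext => i; rewrite eval_rename.
- by move=> n psi IH m s e; rewrite IH.
- by move=> n psi IH1 chi IH2 m s e; rewrite IH1 IH2.
- move=> n psi IH m s e; split=> -[a ha]; exists a;
    by [rewrite -env_cons_rename -IH|rewrite IH env_cons_rename].
Qed.

Lemma sat_And n (phi psi : formula L P n) (e : 'I_n -> A) :
  sat M j (And phi psi) e <-> sat M j phi e /\ sat M j psi e.
Proof. by []. Qed.

Fixpoint exs k n : formula L P (k + n) -> formula L P n :=
  match k return formula L P (k + n) -> formula L P n with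
  | 0 => fun phi => phi
  | k'.+1 => fun phi => exs (Ex phi : formula L P (k' + n))
  end.

Definition env_cat k n (y : 'I_k -> A) (e : 'I_n -> A) : 'I_(k + n) -> A :=
  fun i => match fintype.split i with inl i1 => y i1 | inr i2 => e i2 end.

Lemma env_cat_lshift k n (y : 'I_k -> A) (e : 'I_n -> A) i :
  env_cat y e (lshift n i) = y i.
Proof. by rewrite /env_cat; case: split_ordP => l /eqP; rewrite eq_shift // => /eqP ->. Qed.

Lemma env_cat_rshift k n (y : 'I_k -> A) (e : 'I_n -> A) i :
  env_cat y e (rshift k i) = e i.
Proof. by rewrite /env_cat; case: split_ordP => l /eqP; rewrite eq_shift // => /eqP ->. Qed.

Lemma env_cat_cons k n a (y : 'I_k -> A) (e : 'I_n -> A) :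
  (env_cat (env_cons a y) e : 'I_(k.+1 + n) -> A) =
  (env_cons a (env_cat y e) : 'I_(k + n).+1 -> A).
Proof.
apply: funext => i.
have [l ->|l ->] := split_ordP i; rewrite ?env_cat_lshift ?env_cat_rshift /env_cons.
  have [l' ->|->] := unliftP ord0 l.
    rewrite (_ : lshift n (lift ord0 l') = lift ord0 (lshift n l')); last exact: val_inj.
    by rewrite liftK env_cat_lshift.
  rewrite (_ : lshift n ord0 = ord0); last exact: val_inj.
  by rewrite unlift_none.
rewrite (_ : rshift k.+1 l = lift ord0 (rshift k l)); last exact: val_inj.
by rewrite liftK env_cat_rshift.
Qed.

Lemma sat_exs k n (phi : formula L P (k + n)) (e : 'I_n -> A) :
  sat M j (exs phi) e <-> exists y : 'I_k -> A, sat M j phi (env_cat y e).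
Proof.
elim: k phi => [|k IH] phi /=.
  have E (y : 'I_0 -> A) : env_cat y e = e.
    apply: funext => i; have -> : i = rshift 0 i by exact: val_inj.
    by rewrite env_cat_rshift; congr e; apply: val_inj.
  by split=> [h|[y]]; [exists (fun i : 'I_0 => match notF (ltn_ord i) with end)|];
     rewrite E.
rewrite IH; split=> [[y [a h]]|[y h]].
  by exists (env_cons a y); rewrite env_cat_cons.
exists (fun i => y (lift ord0 i)), (y ord0).
rewrite -env_cat_cons (_ : env_cons _ _ = y)//.
by apply: funext => i; rewrite /env_cons; case: unliftP => [l|] ->.
Qed.

Fixpoint conj n (s : seq (formula L P n)) (psi : formula L P n) :=
  if s is phi :: s' then And phi (conj s' psi) else psi.

Lemma sat_conj (T : eqType) n (s : seq T) (phi : T -> formula L P n) psi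
    (e : 'I_n -> A) :
  sat M j (conj [seq phi x | x <- s] psi) e <->
  (forall x, x \in s -> sat M j (phi x) e) /\ sat M j psi e.
Proof.
elim: s => [|x s IH] /=; first by split=> // -[].
rewrite IH; split=> [[h1 [h2 h3]]|[h1 h2]].
  by split=> // y; rewrite inE => /orP[/eqP->|/h2].
by split; [apply: h1; rewrite mem_head|split=> // y ys; apply: h1; rewrite inE ys orbT].
Qed.

End Substitution.

Section Germs.
Variables (R : realType) (L : language) (M : structure L R).

Definition definable_pos_fun (f : R -> R) : Prop :=
  definable M [set x : 'rV[R]_2 |
    0 < x ord0 ord0 /\ x ord0 ord_max = f (x ord0 ord0)].

(* A definable function on the positive reals; its values elsewhere play no
   role, neither in the definability condition nor in the germ. *)
Record pos_fun := PosFun {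
  pos_fun_val :> R -> R;
  _ : definable_pos_fun pos_fun_val }.

HB.instance Definition _ := gen_eqMixin pos_fun.
HB.instance Definition _ := gen_choiceMixin pos_fun.

Definition germ_eq (f g : pos_fun) : bool :=
  `[< \forall t \near 0^'+, f t = g t >].

Lemma germ_eq_refl : reflexive germ_eq.
Proof. by move=> f; apply/asboolP; near=> t. Unshelve. all: by end_near. Qed.

Lemma germ_eq_sym : symmetric germ_eq.
Proof.
by move=> f g; apply/asboolP/asboolP => h; near=> t; apply/esym; near: t.
Unshelve. all: by end_near.
Qed.

Lemma germ_eq_trans : transitive germ_eq.
Proof.
move=> g f h /asboolP fg /asboolP gh; apply/asboolP; near=> t.
by transitivity (g t); near: t.
Unshelve. all: by end_near.
Qed.

Canonical germ_equiv := EquivRel germ_eq germ_eq_refl germ_eq_sym germ_eq_trans.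

Definition germ := {eq_quot germ_eq}.

HB.instance Definition _ := Choice.on germ.
HB.instance Definition _ := EqQuotient.on germ.

Local Notation LF := (field_language L).
Local Notation MF := (over_field M).

Lemma definable_pos_funP (f : R -> R) :
  definable_pos_fun f <-> exists phi : formula LF R 2,
    forall e : 'I_2 -> R, sat MF id phi e <-> 0 < e ord0 /\ e ord_max = f (e ord0).
Proof.
split=> -[phi h]; exists phi.
  move=> e; have := congr1 (fun S => S (\row_i e i)) h.
  rewrite /defined_set /=.
  rewrite (_ : (\row_i e i) ord0 = e); last by apply: funext => i; rewrite mxE.
  by move=> ->.
by apply/seteqP; split=> x /=; rewrite /defined_set /= h.
Qed.

Definition pos_formula n (i : 'I_n) : formula LF R n :=
  Not (Rel (inl LeSym : rsym LF) (env_cons (Var i) (fun=> Par 0))).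

Lemma sat_pos_formula n (i : 'I_n) e : sat MF id (pos_formula i) e <-> 0 < e i.
Proof.
rewrite /= /env_cons unlift_none (_ : ord_max = lift ord0 ord0); last exact: val_inj.
by rewrite liftK /= ltNge; split=> /negP.
Qed.

Lemma definable_pos_cst (c : R) : definable_pos_fun (fun=> c).
Proof.
apply/definable_pos_funP.
exists (And (pos_formula ord0) (Eq (Var ord_max) (Par c))) => e.
by rewrite sat_And sat_pos_formula.
Qed.

Lemma definable_pos_fint (f : fsym LF) (g : 'I_(farity f) -> pos_fun) :
  definable_pos_fun (fun t => fint MF (fun i => g i t)).
Proof.
apply/definable_pos_funP.
have gP i : exists phi : formula LF R 2, forall e : 'I_2 -> R,
    sat MF id phi e <-> 0 < e ord0 /\ e ord_max = g i (e ord0).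
  by apply/definable_pos_funP; case: (g i).
have [phi phiP] := choice gP.
set k := farity f in g gP phi phiP *.
pose s (i : 'I_k) : 'I_2 -> 'I_(k + 2) :=
  fun l => if l == ord0 then rshift k ord0 else lshift 2 i.
pose psi : formula LF R (k + 2) := And (pos_formula (rshift k ord0))
  (Eq (Var (rshift k ord_max)) (App f (fun i : 'I_(farity f) => Var (lshift 2 i)))).
exists (exs (conj [seq rename (phi i) (s i) | i <- enum 'I_k] psi)) => e.
have psiP y : sat MF id psi (env_cat y e) <->
    0 < e ord0 /\ e ord_max = fint MF y.
  rewrite /psi sat_And sat_pos_formula /= !env_cat_rshift.
  by rewrite (_ : (fun i => _) = y)//; apply: funext => i; rewrite env_cat_lshift.
have renP y i : sat MF id (rename (phi i) (s i)) (env_cat y e) <->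
    0 < e ord0 /\ y i = g i (e ord0).
  by rewrite sat_rename phiP /= /s /= env_cat_rshift env_cat_lshift.
rewrite sat_exs; split=> [[y]|[e0 eE]].
  move=> /sat_conj[hy /psiP[e0 ->]]; split=> //.
  congr (fint _); apply: funext => i.
  by have /renP[] := hy i (mem_enum _ _).
exists (fun i => g i (e ord0)); apply/sat_conj; split; last exact/psiP.
by move=> i _; apply/renP.
Qed.

Definition germ_cst (c : R) : germ := \pi_germ (PosFun (definable_pos_cst c)).

Definition germ_structure : structure LF germ :=
  @Structure LF germ
    (fun f h => \pi_germ (PosFun (definable_pos_fint (fun i => repr (h i)))))
    (fun r h => \forall t \near 0^'+, rint MF (fun i => repr (h i) t)).

Definition germ_valuation (h : germ) : R :=
  get [set r : R | exists2 c : R, c != 0 &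
         (fun x => repr h x / x `^ r) @ 0^'+ --> c].

End Germs.

(* The Hardy field is only defined for o-minimal expansions, hence the proof
   that it takes as an argument. *)
Section HardyField.
Variables (R : realType) (L : language) (M : structure L R).

Definition hardy (omin : o_minimal M) : Type := germ M.

Definition hardy_structure (omin : o_minimal M) :
    structure (field_language L) (hardy omin) := germ_structure M.

Definition hardy_cst (omin : o_minimal M) : R -> hardy omin := @germ_cst R L M.

Definition hardy_valuation (omin : o_minimal M) : hardy omin -> R :=
  @germ_valuation R L M.

Definition hardy_extension (omin : o_minimal M) n (V : set 'rV[R]_n) :
    set 'rV[hardy omin]_n :=
  extension (over_field M) (hardy_structure omin) (@hardy_cst omin) V.

End HardyField.

Section Amoebas.
Variables (R : realType) (n : nat).

Definition Log_base (b : R) (x : 'rV[R]_n) : 'rV[R]_n :=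
  \row_i (ln (x ord0 i) / ln b).

Definition amoeba_at (V : set 'rV[R]_n) (t : R) : set 'rV[R]_n :=
  Log_base t^-1 @` V.

(* The limit at 0 of the family of the S t, for t in ]0, eps[. *)
Definition family_limit (eps : R) (S : R -> set 'rV[R]_n) : set 'rV[R]_n :=
  [set y | closure [set p : 'rV[R]_n * R | 0 < p.2 < eps /\ S p.2 p.1] (y, 0)].

Definition log_limit_set (V : set 'rV[R]_n) : set 'rV[R]_n :=
  family_limit 1 (amoeba_at V).

Definition val_Log (F : Type) (v : F -> R) (W : set 'rV[F]_n) : set 'rV[R]_n :=
  [set \row_i - v (h ord0 i) | h in W].

Definition nonarch_amoeba (F : Type) (v : F -> R) (W : set 'rV[F]_n) :
    set 'rV[R]_n :=
  closure (val_Log v W).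

End Amoebas.

Arguments hardy_valuation {R L M} omin _.
Arguments hardy_extension {R L M} omin {n} V.

(* Main.v *)
Require Import Defs.
From mathcomp Require Import all_boot all_order all_algebra.
From mathcomp Require Import all_classical all_reals all_analysis.
From mathcomp Require Import ring lra.
Set Implicit Arguments.
Unset Strict Implicit.
Unset Printing Implicit Defensive.
Import Order.TTheory GRing.Theory Num.Theory.
Import numFieldNormedType.Exports.
Local Open Scope classical_set_scope.
Local Open Scope quotient_scope.
Local Open Scope ring_scope.

(** Everything rests on curves [t |-> h t] in V, definable for small t > 0.
    Such a curve is a point h of the extension of V to a Hardy field, and its
    logarithms ln (h_i t) / ln (1/t) tend to minus the valuation of h_i
    ([ln_asymptotics]); so -v(h) belongs to the logarithmic limit set
    ([val_Log_sub_log_limit_set]). The theorem says that there are enough curves.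

    Curves come from two consequences of o-minimality. A definable property of t
    holds for all small t > 0 or fails for all small t > 0
    ([ominimal_dichotomy]), and a definable family of nonempty subsets of the
    line has a definable section ([definable_choice]). They make satisfaction in
    the Hardy field equivalent to satisfaction at all small t ([los]). A
    definable condition on (t, x) which has solutions x for arbitrarily small t
    has solutions for all small t, hence a solution in the Hardy field, which is
    a curve ([curve_selection]).

    The valuation has its intended meaning because positive germs f are
    asymptotic to c t^r ([pos_asymptotics]). When real powers are definable,
    o-minimality compares f with every power, and r is the cut defined by this
    comparison. The quotient q = f / t^r then lies between t^e and t^-e for every
    e > 0. If q were unbounded, the size of the interval on which q >= y would
    shrink faster than any power of 1/y, against polynomial boundedness
    ([slow_bounded]); so q and 1/q are bounded and q has a nonzero limit.

    Let y be a point of the limit set of V. For every e > 0 and all small t,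
    some x in V has x_i t^(y_i) between t^e and t^-e for all i. With real powers,
    the best factor 1/k(t) for which some x in V satisfies
    k(t) <= x_i t^(y_i) <= 1/k(t) is a definable function of t, at most t^-e for
    every e, hence bounded. This upgrades approximate solutions to a curve in V
    along which all the x_i t^(y_i) stay in a fixed compact subset of the
    positive reals, so that its valuation is exactly -y
    ([log_limit_set_sub_val_Log]).

    Without real powers one can still impose
    t^2 <= x_i^N t^(k_i) <= t^-2, with k_i the integral part of N y_i. This gives
    curves definable in M with valuation within 3/N of -y
    ([log_limit_set_sub_closure]), and the opposite of the valuation of a positive germ
    definable in M is an exponent of M ([germ_valuation_exponent]). As the limit set is closed, both
    amoebas coincide with it. *)

(** * Definable predicates and maps *)

Section Definability.
Variables (L : language) (A : Type) (N : structure L A).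

(** Definability is phrased for predicates on tuples [e : 'I_n -> A] and not
    for sets of row vectors, because tuples can be reindexed and extended by
    [env_cons]: the definability of a concrete formula is then proved by
    following its syntax, without writing de Bruijn formulas. *)
Definition dpred n (P : ('I_n -> A) -> Prop) : Prop :=
  exists phi : formula L A n, forall e, sat N id phi e <-> P e.

(** The value comes first in the graph, where a quantifier binds it. *)
Definition dfun n (f : ('I_n -> A) -> A) : Prop :=
  dpred (fun e : 'I_n.+1 -> A => e ord0 = f (fun i => e (lift ord0 i))).

Lemma dpred_sat n (phi : formula L A n) : dpred (sat N id phi).
Proof. by exists phi. Qed.

Lemma dpred_ext n (P Q : ('I_n -> A) -> Prop) :
  (forall e, P e <-> Q e) -> dpred P -> dpred Q.
Proof. by move=> PQ [phi phiP]; exists phi => e; rewrite phiP. Qed.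

Lemma dfun_ext n (f g : ('I_n -> A) -> A) : f =1 g -> dfun f -> dfun g.
Proof. by move=> fg; apply: dpred_ext => e; rewrite fg. Qed.

Lemma dpred_not n (P : ('I_n -> A) -> Prop) : dpred P -> dpred (fun e => ~ P e).
Proof. by move=> [phi phiP]; exists (Not phi) => e /=; rewrite phiP. Qed.

Lemma dpred_and n (P Q : ('I_n -> A) -> Prop) :
  dpred P -> dpred Q -> dpred (fun e => P e /\ Q e).
Proof.
by move=> [phi phiP] [psi psiP]; exists (And phi psi) => e /=; rewrite phiP psiP.
Qed.

Lemma dpred_or n (P Q : ('I_n -> A) -> Prop) :
  dpred P -> dpred Q -> dpred (fun e => P e \/ Q e).
Proof.
move=> dP dQ.
apply: dpred_ext (dpred_not (dpred_and (dpred_not dP) (dpred_not dQ))) => e.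
split=> [h|PQ [nP nQ]]; last by case: PQ.
by have [?|nP] := pselect (P e); [left|right; apply: contrapT => nQ; exact: h].
Qed.

Lemma dpred_imp n (P Q : ('I_n -> A) -> Prop) :
  dpred P -> dpred Q -> dpred (fun e => P e -> Q e).
Proof.
move=> dP dQ; apply: dpred_ext (dpred_or (dpred_not dP) dQ) => e.
by split=> [[nP /nP//|//]|PQ]; have [/PQ|] := pselect (P e); [right|left].
Qed.

Lemma env_consE (a : A) n (e : 'I_n -> A) :
  (env_cons a e ord0 = a) * ((fun i => env_cons a e (lift ord0 i)) = e).
Proof.
split; rewrite /env_cons ?unlift_none//.
by apply: funext => i; rewrite liftK.
Qed.

Lemma env_cons_surj n (e : 'I_n.+1 -> A) :
  env_cons (e ord0) (fun i => e (lift ord0 i)) = e.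
Proof. by apply: funext => i; rewrite /env_cons; case: unliftP => [j|] ->. Qed.

Lemma dpred_ex n (Q : A -> ('I_n -> A) -> Prop) :
  dpred (fun e : 'I_n.+1 -> A => Q (e ord0) (fun i => e (lift ord0 i))) ->
  dpred (fun e => exists a, Q a e).
Proof.
move=> [phi phiP]; exists (Ex phi) => e /=.
by split=> -[a h]; exists a; move: h; rewrite phiP !env_consE.
Qed.

Lemma dpred_all n (Q : A -> ('I_n -> A) -> Prop) :
  dpred (fun e : 'I_n.+1 -> A => Q (e ord0) (fun i => e (lift ord0 i))) ->
  dpred (fun e => forall a, Q a e).
Proof.
move=> dQ; apply: dpred_ext
  (dpred_not (@dpred_ex n (fun a e => ~ Q a e) (dpred_not dQ))) => e /=.
split=> [/forallNP h a|h [a nQ]]; [exact: (contrapT (h a))|exact: nQ (h a)].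
Qed.

Lemma dpred_rename n m (s : 'I_n -> 'I_m) (P : ('I_n -> A) -> Prop) :
  dpred P -> dpred (fun e => P (fun i => e (s i))).
Proof.
by move=> [phi phiP]; exists (rename phi s) => e; rewrite sat_rename phiP.
Qed.

Lemma dpred_exs k n (Q : ('I_k -> A) -> ('I_n -> A) -> Prop) :
  dpred (fun e : 'I_(k + n) -> A =>
    Q (fun i => e (lshift n i)) (fun i => e (rshift k i))) ->
  dpred (fun e => exists y, Q y e).
Proof.
move=> [phi phiP]; exists (exs phi) => e; rewrite sat_exs.
have catE y : (fun i => env_cat y e (lshift n i)) = y :> ('I_k -> A).
  by apply: funext => i; rewrite env_cat_lshift.
have catE' y : (fun i => env_cat y e (rshift k i)) = e.
  by apply: funext => i; rewrite env_cat_rshift.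
by split=> -[y h]; exists y; move: h; rewrite phiP catE catE'.
Qed.

Lemma dpred_finall (a : A) (I : finType) n (P : I -> ('I_n -> A) -> Prop) :
  (forall i, dpred (P i)) -> dpred (fun e => forall i, P i e).
Proof.
move=> /choice[phi phiP].
exists (conj [seq phi i | i <- enum I] (Eq (Par a) (Par a))) => e.
rewrite sat_conj; split=> [[h _] i|h]; first exact/phiP/h/mem_enum.
by split=> // i _; apply/phiP.
Qed.

(** Substitution: an existential block names the values [f i e], and its
    bound variables are constrained by the graphs of the [f i]. The point [a]
    supplies the trivially true equation that ends their conjunction. *)
Lemma dpred_subst (a : A) k m (P : ('I_k -> A) -> Prop)
    (f : 'I_k -> ('I_m -> A) -> A) :
  dpred P -> (forall i, dfun (f i)) -> dpred (fun e => P (fun i => f i e)).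
Proof.
move=> dP df.
have : dpred (fun e => exists y : 'I_k -> A, (forall i, y i = f i e) /\ P y).
  apply: dpred_exs; apply: dpred_and; last exact: dpred_rename.
  apply: dpred_finall => // i.
  have := @dpred_rename _ (k + m) (env_cons (lshift m i) (@rshift k m)) _ (df i).
  apply: dpred_ext => e.
  rewrite {1}/env_cons unlift_none.
  by under [X in f i X]eq_fun do rewrite /env_cons liftK.
apply: dpred_ext => e; split=> [[y [ye]]|Pe]; last by exists (fun i => f i e).
by congr P; apply: funext.
Qed.

Lemma dfun_subst (a : A) k m (g : ('I_k -> A) -> A) (f : 'I_k -> ('I_m -> A) -> A) :
  dfun g -> (forall i, dfun (f i)) -> dfun (fun e => g (fun i => f i e)).
Proof.
move=> dg df.
have := @dpred_subst a k.+1 m.+1 _ (fun i e =>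
  if unlift ord0 i is Some j then f j (fun i => e (lift ord0 i)) else e ord0) dg.
rewrite /dfun => H; apply: dpred_ext (H _) => [e|i].
  by rewrite unlift_none; under eq_fun do rewrite liftK.
case: unliftP => [j|] _.
  have := @dpred_rename _ m.+2
    (env_cons ord0 (fun i => lift ord0 (lift ord0 i))) _ (df j).
  apply: dpred_ext => e.
  rewrite {1}/env_cons unlift_none.
  by under [X in f j X]eq_fun do rewrite /env_cons liftK.
by exists (Eq (Var ord0) (Var (lift ord0 ord0))).
Qed.

Lemma dfun_var n (i : 'I_n) : dfun (fun e => e i).
Proof. by exists (Eq (Var ord0) (Var (lift ord0 i))). Qed.

Lemma dfun_cst n (c : A) : dfun (fun _ : 'I_n -> A => c).
Proof. by exists (Eq (Var ord0) (Par c)). Qed.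

Lemma dfun_fint n (f : Defs.fsym L) (g : 'I_(farity f) -> ('I_n -> A) -> A) (a : A) :
  (forall i, dfun (g i)) -> dfun (fun e => fint N (fun i => g i e)).
Proof.
apply: (dfun_subst a).
by exists (Eq (Var ord0) (App f (fun i => Var (lift ord0 i)))).
Qed.

Lemma dpred_rint n (r : rsym L) (g : 'I_(rarity r) -> ('I_n -> A) -> A) (a : A) :
  (forall i, dfun (g i)) -> dpred (fun e => rint N (fun i => g i e)).
Proof. by apply: (dpred_subst a); exists (Rel r (fun i => Var i)). Qed.

Lemma dpred_eq (a : A) n (f g : ('I_n -> A) -> A) :
  dfun f -> dfun g -> dpred (fun e => f e = g e).
Proof.
move=> df dg.
apply: (@dpred_subst a 2 n (fun e => e ord0 = e ord_max)
  (fun i => if i == ord0 then f else g)).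
  by exists (Eq (Var ord0) (Var ord_max)).
by move=> i; case: ifP.
Qed.

Lemma dfun_if n (P : ('I_n -> A) -> Prop) (f g : ('I_n -> A) -> A) :
  dpred P -> dfun f -> dfun g -> dfun (fun e => if `[< P e >] then f e else g e).
Proof.
move=> dP df dg; have dP' := dpred_rename (lift ord0) dP.
apply: dpred_ext (dpred_or (dpred_and dP' df) (dpred_and (dpred_not dP') dg)).
move=> e; case: asboolP => Pe; split; try by [tauto|case=> -[]//; tauto].
Qed.

End Definability.

(** * Definability over an expansion of the real field *)

Section OrderedField.
Variables (R : realType) (L : language) (M : structure L R).
Local Notation MF := (over_field M).
Local Notation dpred := (@dpred (field_language L) R MF).
Local Notation dfun := (@dfun (field_language L) R MF).

Lemma dpred_le n (f g : ('I_n -> R) -> R) :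
  dfun f -> dfun g -> dpred (fun e => f e <= g e).
Proof.
move=> df dg.
have := @dpred_rint _ _ MF n (inl LeSym) (fun i => if i == ord0 then f else g) 0.
by apply=> i /=; case: ifP.
Qed.

Lemma dpred_lt n (f g : ('I_n -> R) -> R) :
  dfun f -> dfun g -> dpred (fun e => f e < g e).
Proof.
move=> df dg; apply: dpred_ext (dpred_not (dpred_le dg df)) => e.
by rewrite ltNge; split=> /negP.
Qed.

Lemma dfun_add n (f g : ('I_n -> R) -> R) :
  dfun f -> dfun g -> dfun (fun e => f e + g e).
Proof.
move=> df dg.
have := @dfun_fint _ _ MF n (inl AddSym) (fun i => if i == ord0 then f else g) 0.
by apply=> i /=; case: ifP.
Qed.

Lemma dfun_mul n (f g : ('I_n -> R) -> R) :
  dfun f -> dfun g -> dfun (fun e => f e * g e).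
Proof.
move=> df dg.
have := @dfun_fint _ _ MF n (inl MulSym) (fun i => if i == ord0 then f else g) 0.
by apply=> i /=; case: ifP.
Qed.

Lemma dfun_opp n (f : ('I_n -> R) -> R) : dfun f -> dfun (fun e => - f e).
Proof.
by move=> df; apply: dfun_ext (dfun_mul (dfun_cst MF n (-1)) df) => e; rewrite mulN1r.
Qed.

Lemma dfun_sub n (f g : ('I_n -> R) -> R) :
  dfun f -> dfun g -> dfun (fun e => f e - g e).
Proof. by move=> df dg; apply: dfun_add df (dfun_opp dg). Qed.

Lemma dfun_weaken n (f : ('I_n -> R) -> R) :
  dfun f -> dfun (fun e : 'I_n.+1 -> R => f (fun i => e (lift ord0 i))).
Proof. by move=> df; apply: (dfun_subst 0) df _ => i; exact: dfun_var. Qed.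

Lemma dfun_inv n (f : ('I_n -> R) -> R) : dfun f -> dfun (fun e => (f e)^-1).
Proof.
move=> /dfun_weaken df; have d0 := dfun_var MF (ord0 : 'I_n.+1).
apply: dpred_ext (dpred_or (dpred_eq 0 (dfun_mul df d0) (dfun_cst MF _ 1))
  (dpred_and (dpred_eq 0 df (dfun_cst MF _ 0)) (dpred_eq 0 d0 (dfun_cst MF _ 0)))).
move=> e; split=> [[fe|[-> ->]]|->]; last 2 first.
- by rewrite invr0.
- have [->|f0] := eqVneq (f (fun i => e (lift ord0 i))) 0; last by left; rewrite divff.
  by right; rewrite invr0.
have f0 : f (fun i => e (lift ord0 i)) != 0.
  by apply: contra_eq_neq fe => ->; rewrite mul0r eq_sym oner_eq0.
by apply: (mulfI f0); rewrite fe divff.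
Qed.

Lemma dfun_exp n (f : ('I_n -> R) -> R) k : dfun f -> dfun (fun e => f e ^+ k).
Proof.
move=> df; elim: k => [|k IH]; first exact: (dfun_cst MF n 1).
by apply: dfun_ext (dfun_mul df IH) => e; rewrite exprS.
Qed.

Lemma dfun_exprz n (f : ('I_n -> R) -> R) (k : int) :
  dfun f -> dfun (fun e => f e ^ k).
Proof. by case: k => k df; [exact: dfun_exp|exact/dfun_inv/dfun_exp]. Qed.

(** Substitution in a family [Q] of subsets of the line; the curried form is
    the one that quantifiers and [sup] produce. *)
Lemma dpred_family n m (Q : R -> ('I_n -> R) -> Prop) (f : ('I_m -> R) -> R)
    (s : 'I_n -> ('I_m -> R) -> R) :
  dpred (fun e : 'I_n.+1 -> R => Q (e ord0) (fun i => e (lift ord0 i))) ->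
  dfun f -> (forall i, dfun (s i)) -> dpred (fun e => Q (f e) (fun i => s i e)).
Proof.
move=> dQ df ds.
have := @dpred_subst _ _ MF 0 _ m _
  (fun i => if unlift ord0 i is Some j then s j else f) dQ.
rewrite unlift_none; under eq_fun do under eq_fun do rewrite liftK.
by apply=> i; case: unliftP.
Qed.

(** A supremum is first-order: it is the least upper bound when there is one,
    and [sup] has the constant value 0 otherwise. *)
Lemma dfun_sup n (Q : R -> ('I_n -> R) -> Prop) :
  dpred (fun e : 'I_n.+1 -> R => Q (e ord0) (fun i => e (lift ord0 i))) ->
  dfun (fun e => sup [set x | Q x e]).
Proof.
move=> dQ.
have ub_dpred : dpred (fun e : 'I_n.+1 -> R =>
    ubound [set x | Q x (fun i => e (lift ord0 i))] (e ord0)).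
  apply: dpred_all; apply: dpred_imp.
    apply: (dpred_family dQ) => [|i]; exact: dfun_var.
  apply: dpred_le; exact: dfun_var.
have has_dpred : dpred (fun e : 'I_n.+1 -> R =>
    has_sup [set x | Q x (fun i => e (lift ord0 i))]).
  apply: dpred_and; apply: dpred_ex.
    apply: (dpred_family dQ) => [|i]; exact: dfun_var.
  apply: (dpred_family (Q := fun b e => ubound [set x | Q x e] b)) => //.
    exact: dfun_var.
  by move=> i; exact: dfun_var.
have least_dpred : dpred (fun e : 'I_n.+1 -> R => forall b,
    ubound [set x | Q x (fun i => e (lift ord0 i))] b -> e ord0 <= b).
  apply: dpred_all; apply: dpred_imp.
    apply: (dpred_family (Q := fun b e => ubound [set x | Q x e] b)) => //.
      exact: dfun_var.
    by move=> i; exact: dfun_var.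
  apply: dpred_le; exact: dfun_var.
have := dpred_or (dpred_and has_dpred (dpred_and ub_dpred least_dpred))
  (dpred_and (dpred_not has_dpred)
    (dpred_eq 0 (dfun_var MF (ord0 : 'I_n.+1)) (dfun_cst MF _ 0))).
apply: dpred_ext => e; set A := [set x | _].
split=> [[[hA [ubA leA]]|[hA ->]]|->].
- apply/eqP; rewrite eq_le leA ?ge_sup //; first by case: hA.
  by move=> x Ax; apply: ub_le_sup => //; case: hA.
- by rewrite sup_out.
have [hA|hA] := pselect (has_sup A); last by right; rewrite sup_out.
left; split=> //; split; first exact: sup_upper_bound.
by move=> b ubb; apply: ge_sup => //; case: hA.
Qed.

Lemma dfun_comp1 n (F : R -> R) (f : ('I_n -> R) -> R) :
  dfun (fun e : 'I_1 -> R => F (e ord0)) -> dfun f -> dfun (fun e => F (f e)).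
Proof. by move=> dF df; exact: (@dfun_subst _ _ MF 0 1 n _ (fun=> f) dF (fun=> df)). Qed.

Lemma dpred_comp1 n (P : R -> Prop) (f : ('I_n -> R) -> R) :
  dpred (fun e : 'I_1 -> R => P (e ord0)) -> dfun f -> dpred (fun e => P (f e)).
Proof. by move=> dP df; exact: (@dpred_subst _ _ MF 0 1 n _ (fun=> f) dP (fun=> df)). Qed.

End OrderedField.

(** * O-minimality at the origin and definable choice *)

Lemma near0P (R : realType) (P : R -> Prop) : (\forall t \near 0^'+, P t) <->
  exists2 d : R, 0 < d & forall t, 0 < t < d -> P t.
Proof.
split=> [|[d d0 dP]].
  rewrite near_withinE => /nbhs_ballP[d /= d0 dP]; exists d => // t /andP[t0 td].
  by apply: dP => //; rewrite /ball /= sub0r normrN gtr0_norm.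
near=> t; apply: dP; apply/andP; split; near: t.
  exact: nbhs_right_gt.
exact: nbhs_right_lt.
Unshelve. all: by end_near. Qed.

Lemma near0_itv (R : realType) (I : interval R) :
  (\forall t \near 0^'+, t \in I) \/ (\forall t \near 0^'+, t \notin I).
Proof.
case: I => a b.
have bound (c : itv_bound R) :
    (\forall t \near 0^'+, (BLeft t < c)%O) \/ (\forall t \near 0^'+, (c <= BLeft t)%O).
  case: c => [c x|c]; last by case: c; [right|left]; near=> t.
  have [x0|x0] := ltP 0 x.
    left; near=> t.
    suff tx : t < x by case: c; rewrite bnd_simp ?tx ?(ltW tx).
    by near: t; exact: nbhs_right_lt.
  right; near=> t.
  have tx : x < t by rewrite (le_lt_trans x0).
  by case: c; rewrite bnd_simp ?tx ?(ltW tx).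
have bound' (c : itv_bound R) :
    (\forall t \near 0^'+, (BRight t <= c)%O) \/ (\forall t \near 0^'+, (c < BRight t)%O).
  case: c => [c x|c]; last by case: c; [right|left]; near=> t.
  have [x0|x0] := ltP 0 x.
    left; near=> t.
    suff tx : t < x by case: c; rewrite bnd_simp ?tx ?(ltW tx).
    by near: t; exact: nbhs_right_lt.
  right; near=> t.
  have tx : x < t by rewrite (le_lt_trans x0).
  by case: c; rewrite bnd_simp ?tx ?(ltW tx).
have [la|la] := bound a.
  by right; near=> t; rewrite itv_boundlr negb_and -!ltNge (near la).
have [rb|rb] := bound' b; last first.
  by right; near=> t; rewrite itv_boundlr negb_and -!ltNge (near rb) ?orbT.
by left; near=> t; rewrite itv_boundlr (near la) // (near rb).
Unshelve. all: by end_near. Qed.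

Section OMinimal.
Variables (R : realType) (L : language) (M : structure L R).
Local Notation MF := (over_field M).
Local Notation dpred := (@dpred (field_language L) R MF).
Local Notation dfun := (@dfun (field_language L) R MF).

Lemma definableP n (V : set 'rV[R]_n) :
  definable M V <-> dpred (fun e => V (\row_i e i)).
Proof.
split=> -[phi phiP]; exists phi.
  move=> e; rewrite -phiP /defined_set /=.
  by rewrite (_ : (\row_i e i) ord0 = e)//; apply: funext => i; rewrite mxE.
apply/seteqP; split=> x; rewrite /defined_set /= phiP;
  by rewrite (_ : \row_i x ord0 i = x)//; apply/rowP => i; rewrite mxE.
Qed.

Lemma definable_funP (f : R -> R) :
  definable_fun M f <-> dfun (fun e : 'I_1 -> R => f (e ord0)).
Proof.
rewrite /definable_fun definableP.
have l1 : lift ord0 ord0 = ord_max :> 'I_2 by exact: val_inj.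
pose s (i : 'I_2) : 'I_2 := if i == ord0 then ord_max else ord0.
split=> /(@dpred_rename _ _ _ _ 2 s); apply: dpred_ext => e; rewrite ?mxE /=.
  by rewrite l1 !mxE.
by rewrite !mxE l1.
Qed.

(** Extension by 0 turns a function given on the positive reals into a total
    one, to which the closure properties of [dfun] apply. *)
Lemma definable_pos_fun_dfun (f : R -> R) : definable_pos_fun M f <->
  dfun (fun e : 'I_1 -> R => if 0 < e ord0 then f (e ord0) else 0).
Proof.
have l1 : lift ord0 ord0 = ord_max :> 'I_2 by exact: val_inj.
pose s (i : 'I_2) : 'I_2 := if i == ord0 then ord_max else ord0.
have dpos : dpred (fun e : 'I_2 -> R => 0 < e ord0).
  by apply: dpred_lt; [exact: dfun_cst|exact: dfun_var].
rewrite definable_pos_funP; split=> [|df].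
  move=> /(@dpred_rename _ _ _ _ 2 s) df.
  have d0 : dpred (fun e : 'I_2 -> R => ~ (0 < e ord_max) /\ e ord0 = 0).
    apply: dpred_and.
      apply: dpred_not; apply: dpred_lt; [exact: dfun_cst|exact: dfun_var].
    apply: (dpred_eq 0); [exact: dfun_var|exact: dfun_cst].
  apply: dpred_ext (dpred_or df d0) => e; rewrite /s /= l1.
  case: ifPn => e0; first by split=> [[[]|[]]|] //; left.
  by split=> [[[]|[]]|] //; right.
apply: dpred_ext (dpred_and dpos (dpred_rename s df)) => e /=.
by rewrite l1; split=> -[e0]; rewrite /s /= e0.
Qed.

Lemma definable_pos_fun_pos (f : R -> R) (F : ('I_1 -> R) -> R) : dfun F ->
  (forall t, 0 < t -> F (fun=> t) = f t) -> definable_pos_fun M f.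
Proof.
move=> dF Ff; apply/definable_pos_fun_dfun.
have := dfun_if (dpred_lt (dfun_cst MF 1 0) (dfun_var MF (ord0 : 'I_1)))
  dF (dfun_cst MF 1 0).
apply: dfun_ext => e; case: asboolP => [e0|/negP/negbTE -> //].
rewrite e0 -Ff //; congr F; apply: funext => i.
by rewrite (ord1 i).
Qed.

Hypothesis omin : o_minimal M.

(** This is all that is used of o-minimality: an interval contains all small
    positive numbers or none of them, and hence so does a finite union. *)
Lemma ominimal_dichotomy (P : R -> Prop) : dpred (fun e : 'I_1 -> R => P (e ord0)) ->
  (\forall t \near 0^'+, P t) \/ (\forall t \near 0^'+, ~ P t).
Proof.
move=> dP; have /omin[s ->] : definable_subset M P.
  by apply/definableP; apply: dpred_ext dP => e /=; rewrite mxE.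
elim: s => [|I s IH]; first by right; near=> t; rewrite big_nil.
rewrite big_cons; have [tI|tI] := near0_itv I.
  by left; near=> t; left; exact: (near tI).
case: IH => ts; first by left; near=> t; right; exact: (near ts).
right; near=> t; case; last exact: (near ts).
by apply/negP; exact: (near tI).
Unshelve. all: by end_near. Qed.

(** A point of B which depends only on B: its supremum if B contains it, and
    otherwise the midpoint of the last interval of B, of which only a final part
    of length at most 1 is kept so that its length is finite. *)
Definition pick_below (B : set R) : R :=
  if `[< B (sup B) >] then sup B else
  sup B - sup [set d | d <= 1 /\ forall z, sup B - d < z < sup B -> B z] / 2.

(** If the supremum s is not in Q, the dichotomy for [t |-> Q (s - t)] shows
    that Q contains an interval ending at s: otherwise Q would stay away from
    s. *)
Lemma pick_belowP (Q : set R) : dpred (fun e : 'I_1 -> R => Q (e ord0)) ->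
  has_sup Q -> Q (pick_below Q).
Proof.
move=> dQ supQ; rewrite /pick_below; case: asboolP => // nQ.
set s := sup Q in nQ *; set D := [set d | _].
have dsub : dpred (fun e : 'I_1 -> R => Q (s - e ord0)).
  apply: (dpred_comp1 dQ); apply: dfun_sub; [exact: dfun_cst|exact: dfun_var].
have [d d0 dD] : exists2 d, 0 < d & D d.
  have [/near0P[d d0 dP]|/near0P[d d0 dP]] := @ominimal_dichotomy (fun d => Q (s - d)) dsub.
    exists (Num.min d 1); first by rewrite lt_min d0 ltr01.
    split; first by rewrite ge_min lexx orbT.
    move=> z /andP[sz zs]; rewrite -[z](subKr s); apply: dP.
    rewrite subr_gt0 zs /= ltrBlDl -ltrBlDr (le_lt_trans _ sz) //.
    by rewrite lerD2l lerN2 ge_min lexx.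
  have [x Qx sx] := sup_adherent d0 supQ.
  have xs : x <= s by apply: sup_upper_bound.
  have [xE|xs'] := eqVneq x s; first by rewrite xE in Qx.
  have [] := dP (s - x); last by rewrite subKr.
  by rewrite subr_gt0 lt_neqAle xs' xs /= ltrBlDl -ltrBlDr.
have supD : has_sup D by split; [exists d|exists 1 => x []].
have dsupD : d <= sup D by apply: sup_upper_bound.
have supD0 : 0 < sup D by rewrite (lt_le_trans d0).
have [e [_ eD] ve] := sup_adherent (divr_gt0 supD0 (ltr0n _ 2)) supD.
apply: eD; rewrite ltrD2l ltrN2 gtrBl divr_gt0 // andbT.
by move: ve; rewrite {1}[sup D]splitr addrK.
Qed.

Lemma dfun_pick_below n (Q : R -> ('I_n -> R) -> Prop) :
  dpred (fun e : 'I_n.+1 -> R => Q (e ord0) (fun i => e (lift ord0 i))) ->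
  dfun (fun e => pick_below [set x | Q x e]).
Proof.
move=> dQ; have dsup := dfun_sup dQ.
apply: dfun_if => //.
  by apply: (dpred_family dQ) => // i; exact: dfun_var.
apply: dfun_sub => //; apply: dfun_mul; last exact: dfun_cst.
apply: dfun_sup; apply: dpred_and.
  by apply: dpred_le; [exact: dfun_var|exact: dfun_cst].
have dsup2 : dfun (fun e : 'I_n.+2 -> R =>
    sup [set x | Q x (fun i => e (lift ord0 (lift ord0 i)))]).
  by apply: (dfun_subst 0 dsup) => i; exact: dfun_var.
apply: dpred_all; apply: dpred_imp.
  apply: dpred_ext (dpred_and _ _) => [e||].
  - by split=> [h|/andP]; [apply/andP; exact: h|exact].
  - apply: dpred_lt; last exact: dfun_var.
    by apply: dfun_sub => //; exact: dfun_var.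
  - by apply: dpred_lt => //; exact: dfun_var.
by apply: (dpred_family dQ) => [|i]; exact: dfun_var.
Qed.

(** [pick_below] requires sets that are bounded above, so it is applied to
    the part of the fibre in the nonpositive half-line, or if this is empty to
    the opposite of the fibre. *)
Lemma definable_choice n (Q : R -> ('I_n -> R) -> Prop) :
  dpred (fun e : 'I_n.+1 -> R => Q (e ord0) (fun i => e (lift ord0 i))) ->
  exists2 f, dfun f & forall e, (exists a, Q a e) -> Q (f e) e.
Proof.
move=> dQ.
pose Q1 x e := x <= 0 /\ Q x e; pose Q2 x e := x <= 0 /\ Q (- x) e.
have dQ1 : dpred (fun e : 'I_n.+1 -> R => Q1 (e ord0) (fun i => e (lift ord0 i))).
  by apply: dpred_and => //; apply: dpred_le; [exact: dfun_var|exact: dfun_cst].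
have dQ2 : dpred (fun e : 'I_n.+1 -> R => Q2 (e ord0) (fun i => e (lift ord0 i))).
  apply: dpred_and => //; first by apply: dpred_le; [exact: dfun_var|exact: dfun_cst].
  apply: (dpred_family dQ) => [|i]; last exact: dfun_var.
  by apply: dfun_opp; exact: dfun_var.
have fibre (P : R -> ('I_n -> R) -> Prop) e :
    dpred (fun e : 'I_n.+1 -> R => P (e ord0) (fun i => e (lift ord0 i))) ->
    dpred (fun x : 'I_1 -> R => P (x ord0) e).
  move=> dP; have := @dpred_family _ _ M _ 1 P (fun x => x ord0) (fun i _ => e i) dP.
  by apply=> [|i]; [exact: dfun_var|exact: dfun_cst].
exists (fun e => if `[< exists x, Q1 x e >] then pick_below [set x | Q1 x e]
                 else - pick_below [set x | Q2 x e]).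
  apply: dfun_if; [exact: dpred_ex|exact: dfun_pick_below|].
  by apply: dfun_opp; exact: dfun_pick_below.
move=> e [a Qa]; case: asboolP => [[x xQ]|nQ].
  suff : Q1 (pick_below [set x | Q1 x e]) e by case.
  apply: (@pick_belowP [set x | Q1 x e]); first exact: fibre.
  by split; [exists x|exists 0 => ? []].
suff : Q2 (pick_below [set x | Q2 x e]) e by case.
apply: (@pick_belowP [set x | Q2 x e]); first exact: fibre.
split; last by exists 0 => ? [].
exists (- a); split; last by rewrite opprK.
by rewrite oppr_le0 leNgt; apply/negP => /ltW a0; apply: nQ; exists a.
Qed.

End OMinimal.

(** * Germs satisfy what holds eventually *)

Section Los.
Variables (R : realType) (L : language) (M : structure L R).
Local Notation MF := (over_field M).
Local Notation LF := (field_language L).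
Local Notation germ_eval h u :=
  (Defs.eval (germ_structure M) (@germ_cst R L M) h u).
Local Notation dpred := (@dpred LF R MF).
Local Notation dfun := (@dfun LF R MF).

Lemma repr_germ (g : pos_fun M) :
  \forall t \near 0^'+, repr (\pi_(germ M) g) t = g t.
Proof.
have : (repr (\pi_(germ M) g) = g %[mod germ M])%qT by rewrite reprK.
by move=> /eqquotP/asboolP.
Qed.

Lemma eval_germ n (u : term LF R n) (h : 'I_n -> germ M) :
  \forall t \near 0^'+, repr (germ_eval h u) t =
                        Defs.eval MF id (fun i => repr (h i) t) u.
Proof.
elim: u => [i|c|f u IH]; [by near=> t|exact: repr_germ|].
have uE : \forall t \near 0^'+, forall i, repr (germ_eval h (u i)) t =
    Defs.eval MF id (fun i => repr (h i) t) (u i) by exact: filter_forall.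
pose a := PosFun (definable_pos_fint (fun i => repr (germ_eval h (u i)))).
apply: filterS2 uE (repr_germ a) => t uEt aE.
transitivity (a t); first exact: aE.
by congr (@fint _ _ MF f); apply: funext => i; exact: uEt.
Unshelve. all: by end_near. Qed.

Lemma pos_fun_dfun (g : pos_fun M) :
  dfun (fun e : 'I_1 -> R => if 0 < e ord0 then g (e ord0) else 0).
Proof. by apply/definable_pos_fun_dfun; case: g. Qed.

Lemma definable_pos_comp n (f : ('I_n -> R) -> R) (g : 'I_n -> pos_fun M) :
  dfun f -> definable_pos_fun M (fun t => f (fun i => g i t)).
Proof.
move=> df; apply: (definable_pos_fun_pos
  (F := fun e => f (fun i => if 0 < e ord0 then g i (e ord0) else 0))).
  by apply: (dfun_subst 0 df) => i; exact: pos_fun_dfun.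
by move=> t t0; rewrite t0.
Qed.

Hypothesis omin : o_minimal M.

Lemma germ_dichotomy n (P : ('I_n -> R) -> Prop) (g : 'I_n -> pos_fun M) : dpred P ->
  (\forall t \near 0^'+, P (fun i => g i t)) \/
  (\forall t \near 0^'+, ~ P (fun i => g i t)).
Proof.
move=> dP.
pose Q t := P (fun i => if 0 < t then g i t else 0).
have dQ : dpred (fun e : 'I_1 -> R => Q (e ord0)).
  by apply: (dpred_subst 0 dP) => i; exact: pos_fun_dfun.
have t0 : \forall t \near (0 : R)^'+, 0 < t by exact: nbhs_right_gt.
have [tQ|tQ] := ominimal_dichotomy omin dQ; [left|right]; near=> t;
  by have := near tQ t; rewrite /Q (near t0 t)//; apply.
Unshelve. all: by end_near. Qed.

(** Induction on the formula, as for an ultraproduct: the dichotomy at the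
    origin replaces maximality of the filter in the case of a negation, and
    definable choice provides the witness of an existential quantifier as a
    definable germ. *)
Theorem los n (phi : formula LF R n) (h : 'I_n -> germ M) :
  sat (germ_structure M) (@germ_cst R L M) phi h <->
  \forall t \near 0^'+, sat MF id phi (fun i => repr (h i) t).
Proof.
elim: phi h => {n} [n u v|n r u|n psi IH|n psi IH1 chi IH2|n psi IH] h /=.
- split=> [uv|uv].
    near=> t; rewrite -(near (eval_germ u h) t)// -(near (eval_germ v h) t)//.
    by rewrite uv.
  rewrite -[LHS]reprK -[RHS]reprK; apply/eqquotP/asboolP; near=> t.
  by rewrite (near (eval_germ u h) t)// (near (eval_germ v h) t)// (near uv t).
- have ru : \forall t \near 0^'+, forall i : 'I_(rarity r),
      repr (germ_eval h (u i)) t =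
      Defs.eval MF id (fun i => repr (h i) t) (u i).
    by apply: filter_forall => i; exact: eval_germ.
  by split; apply: filterS2 ru => t rut; rewrite -(funext rut).
- rewrite IH; split=> [nP|P' P].
    by have [/nP|] := germ_dichotomy (fun i => repr (h i)) (dpred_sat MF psi).
  have : \forall t \near (0 : R)^'+, False.
    by near=> t; apply: (near P' t) => //; exact: (near P t).
  by move=> /filter_ex[].
- rewrite IH1 IH2; split=> [[P Q]|PQ].
    by near=> t; split; [exact: (near P t)|exact: (near Q t)].
  by split; near=> t; have [] := near PQ t.
have consE (a : germ M) t : (fun i => repr (env_cons a h i) t) =
    env_cons (repr a t) (fun i => repr (h i) t).
  by apply: funext => i; rewrite /env_cons; case: unlift.
split=> [[a /IH aP]|exP].
  by near=> t; exists (repr a t); rewrite -consE; exact: (near aP t).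
pose Q a e := sat MF id psi (env_cons a e).
have dQ : dpred (fun e => Q (e ord0) (fun i => e (lift ord0 i))).
  by exists psi => e; rewrite /Q env_cons_surj.
have [f df fP] := definable_choice omin dQ.
set a := PosFun (definable_pos_comp (fun i => repr (h i)) df).
exists (\pi_(germ M) a); apply/IH; near=> t.
rewrite consE (near (repr_germ a) t)//; apply: fP.
exact: (near exP t).
Unshelve. all: by end_near. Qed.

End Los.

(** * Reducts, real powers and curve selection *)

(** No translation of formulas is built: the satisfaction predicate of a
    formula of the smaller structure is rebuilt, connective by connective, as a
    definable predicate of the larger one. *)
Lemma dpred_reduct (L1 L2 : language) (A : Type) (a : A) (N1 : structure L1 A)
    (N2 : structure L2 A) :
  (forall f : Defs.fsym L1, dfun N2 (fun e : 'I_(farity f) -> A => fint N1 e)) ->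
  (forall r : rsym L1, dpred N2 (fun e : 'I_(rarity r) -> A => rint N1 e)) ->
  forall n (P : ('I_n -> A) -> Prop), dpred N1 P -> dpred N2 P.
Proof.
move=> df dr n P [phi /dpred_ext]; apply.
have deval m (u : term L1 A m) : dfun N2 (fun e => Defs.eval N1 id e u).
  elim: u => [i|c|f u IH] /=; [exact: dfun_var|exact: dfun_cst|].
  exact: (dfun_subst a (df f)).
elim: phi => {n P} [n u v|n r u|n psi IH|n psi IH1 chi IH2|n psi IH] /=.
- exact: dpred_eq.
- exact: (dpred_subst a (dr r)).
- exact: dpred_not.
- exact: dpred_and.
- by apply: dpred_ex; apply: dpred_ext IH => e; rewrite env_cons_surj.
Qed.

Section PowerExpansion.
Variables (R : realType) (L : language) (M : structure L R).

Lemma dpred_power_expansion n (P : ('I_n -> R) -> Prop) :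
  dpred (over_field M) P -> dpred (over_field (power_expansion M)) P.
Proof.
apply: (dpred_reduct 0) => -[s|s].
- exact: (@dfun_fint _ _ (over_field (power_expansion M)) _ (inl s)
    (fun i e => e i) 0 (fun i => dfun_var _ i)).
- exact: (@dfun_fint _ _ (over_field (power_expansion M)) _ (inr (inl s))
    (fun i e => e i) 0 (fun i => dfun_var _ i)).
- exact: (@dpred_rint _ _ (over_field (power_expansion M)) _ (inl s)
    (fun i e => e i) 0 (fun i => dfun_var _ i)).
- exact: (@dpred_rint _ _ (over_field (power_expansion M)) _ (inr (inl s))
    (fun i e => e i) 0 (fun i => dfun_var _ i)).
Qed.

(** The interpretation of the symbol r of the language of powers; [powR] may
    take other values at nonpositive t. *)
Definition pos_power (r t : R) : R := if 0 < t then t `^ r else 0.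

Lemma dfun_pos_power n r (f : ('I_n -> R) -> R) :
  dfun (over_field (power_expansion M)) f ->
  dfun (over_field (power_expansion M)) (fun e => pos_power r (f e)).
Proof.
move=> df; exact: (@dfun_fint _ _ (over_field (power_expansion M)) _ (inr (inr r))
    (fun i : 'I_1 => f) 0 (fun=> df)).
Qed.

End PowerExpansion.

Section CurveSelection.
Variables (R : realType) (L : language) (M : structure L R).
Local Notation MF := (over_field M).
Hypothesis omin : o_minimal M.

Lemma definable_pos_id : definable_pos_fun M id.
Proof.
by apply: (definable_pos_fun_pos (F := fun e => e ord0)) => //; exact: dfun_var.
Qed.

(** The existence of x at all small t is a formula satisfied by the germ of the
    identity in the Hardy field, by [los]; the witnesses in the Hardy field,
    read at small t by [los] again, form the curve. In this way definable choice
    in several variables is reduced to one variable. *)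
Lemma curve_selection n (P : R -> ('I_n -> R) -> Prop) :
  dpred MF (fun e : 'I_n.+1 -> R => P (e ord0) (fun i => e (lift ord0 i))) ->
  (forall d, 0 < d -> exists2 t, 0 < t < d & exists x, P t x) ->
  exists h : 'I_n -> germ M, \forall t \near 0^'+, P t (fun i => repr (h i) t).
Proof.
move=> dP freqP.
have dP' : dpred MF (fun e : 'I_(n + 1) -> R =>
    P (e (rshift n ord0)) (fun i => e (lshift 1 i))).
  by apply: (dpred_family dP) => [|i]; exact: dfun_var.
have dexP : dpred MF (fun e : 'I_1 -> R => exists x, P (e ord0) x).
  exact: (@dpred_exs _ _ _ n 1 (fun x e => P (e ord0) x)).
case: dP' => phi phiP.
have nearP : \forall t \near 0^'+, exists x, P t x.
  have [//|/near0P[d d0 dnP]] :=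
    @ominimal_dichotomy _ _ _ omin (fun t => exists x, P t x) dexP.
  by have [t td /(dnP t td)] := freqP d d0.
pose tau := PosFun definable_pos_id.
have /sat_exs[h hP] : sat (germ_structure M) (@germ_cst R L M) (exs phi)
    (fun=> \pi_(germ M) tau).
  apply/(los omin); apply: filterS2 nearP (repr_germ tau) => t [x Px] tauE.
  apply/sat_exs; exists x; apply/phiP; rewrite env_cat_rshift tauE.
  by under eq_fun do rewrite env_cat_lshift.
exists h; move/(los omin): hP.
apply: filterS2 (repr_germ tau) => t tauE /phiP; rewrite env_cat_rshift tauE.
by under eq_fun do rewrite env_cat_lshift.
Qed.

End CurveSelection.

(** * Germs of a polynomially bounded structure are asymptotic to powers *)

Section RealPowers.
Variable R : realType.
Implicit Types t a b : R.

Lemma powR_pos t a : 0 < t -> t `^ a = expR (a * ln t).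
Proof. by move=> t0; rewrite /powR gt_eqF. Qed.

Lemma ler_powR_lt1 t a b : 0 < t < 1 -> (t `^ a <= t `^ b) = (b <= a).
Proof.
move=> /andP[t0 t1]; rewrite !powR_pos // ler_expR ler_nM2r //.
by rewrite ln_lt0 // t0.
Qed.

Lemma near0_01 : \forall t \near (0 : R)^'+, 0 < t < 1.
Proof. by apply/near0P; exists 1. Qed.

Lemma near0_ex (P : R -> Prop) :
  (\forall t \near 0^'+, P t) -> exists2 t, 0 < t < 1 & P t.
Proof.
move=> /near0P[d d0 dP]; have m0 : 0 < Num.min d 1 by rewrite lt_min d0 ltr01.
have mlt : Num.min d 1 / 2 < Num.min d 1 by rewrite ltr_pdivrMr // ltr_pMr // ltr1n.
exists (Num.min d 1 / 2); first by rewrite divr_gt0 // (lt_le_trans mlt) // ge_min lexx orbT.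
by apply: dP; rewrite divr_gt0 // (lt_le_trans mlt) // ge_min lexx.
Qed.

End RealPowers.

Section Asymptotics.
Variables (R : realType) (L : language) (M : structure L R).
Local Notation MF := (over_field M).
Local Notation dfun1 F := (dfun MF (fun e : 'I_1 -> R => F (e ord0))).
Hypothesis omin : o_minimal M.
Hypothesis pbM : polynomially_bounded M.
Hypothesis dpow : forall r, dfun1 (pos_power r).

Lemma near0_le_dichotomy (f g : R -> R) : dfun1 f -> dfun1 g ->
  (\forall t \near 0^'+, f t <= g t) \/ (\forall t \near 0^'+, g t < f t).
Proof.
move=> df dg.
have [?|fg] := @ominimal_dichotomy _ _ _ omin (fun t => f t <= g t) (dpred_le df dg).
  by left.
by right; apply: filterS fg => t /negP; rewrite -ltNge.
Qed.

Lemma polynomially_bounded_at0 (f : R -> R) : dfun1 f ->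
  exists N : nat, \forall t \near 0^'+, f t <= t `^ (- N%:R).
Proof.
move=> df; have [|N [A [_ AN]]] := pbM (f := fun x => f x^-1).
  by apply/definable_funP/(dfun_comp1 df)/dfun_inv; exact: dfun_var.
exists N; apply/near0P; exists (`|A| + 1)^-1; first by rewrite invr_gt0 ltr_wpDl.
move=> t /andP[t0 tA]; have := AN t^-1; rewrite /= invrK exprVn.
rewrite powRN powR_mulrn ?(ltW t0) // => le; apply: le_trans (ler_norm _) (le _).
rewrite (@lt_trans _ _ (`|A| + 1)) //; first by rewrite ltr_pwDr // ler_norm.
by rewrite -[ltLHS]invrK ltf_pV2 ?posrE // invr_gt0 ltr_wpDl.
Qed.

(** Otherwise g tends to +oo as t tends to 0. Let G y be the length of the
    interval starting at 0 on which g >= y. Polynomial boundedness of 1/G gives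
    G y >= y^-K for large y, so g >= y at t = y^-K / 2. But g t <= t^-e with
    e = 1/(2K) then yields y^(2K) <= 2 y^K, which is false for large y. *)
Lemma slow_bounded (g : R -> R) : dfun1 g ->
  (forall e, 0 < e -> \forall t \near 0^'+, g t <= t `^ (- e)) ->
  exists2 C, 0 < C & \forall t \near 0^'+, g t <= C.
Proof.
move=> dg slow; apply: contrapT => nbd.
have gbig y : \forall t \near 0^'+, y <= g t.
  have [gy|] := near0_le_dichotomy (g := fun=> Num.max y 1) dg (dfun_cst MF 1 _).
    by case: nbd; exists (Num.max y 1) => //; rewrite lt_max ltr01 orbT.
  by apply: filterS => t; rewrite gt_max => /andP[/ltW].
pose D y := [set d | d <= 1 /\ forall t, 0 < t < d -> y <= g t].
pose G y := sup (D y).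
have dG : dfun1 G.
  apply: (@dfun_sup _ _ M 1 (fun d e => d <= 1 /\ forall t, 0 < t < d -> e ord0 <= g t)).
  apply: dpred_and; first by apply: dpred_le; [exact: dfun_var|exact: dfun_cst].
  apply: dpred_all; apply: dpred_imp; last first.
    apply: dpred_le; first exact: dfun_var.
    by apply: (dfun_comp1 dg); exact: dfun_var.
  apply: dpred_ext (dpred_and _ _) => [e||].
  - by split=> [[h1 h2]|/andP]; [apply/andP; split; [exact: h1|exact: h2]|exact].
  - by apply: dpred_lt; [exact: dfun_cst|exact: dfun_var].
  - by apply: dpred_lt; exact: dfun_var.
have DG y : exists2 d, 0 < d & D y d.
  have /near0P[d d0 dy] := gbig y; exists (Num.min d 1).
    by rewrite lt_min d0 ltr01.
  split; first by rewrite ge_min lexx orbT.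
  by move=> t /andP[t0]; rewrite lt_min => /andP[td _]; apply: dy; rewrite t0.
have supD y : has_sup (D y).
  by have [d _ dD] := DG y; split; [exists d|exists 1 => ? []].
have G0 y : 0 < G y.
  have [d d0 dD] := DG y; apply: lt_le_trans d0 _.
  exact: sup_upper_bound.
have [|N FN] := pbM (f := fun y => (G y)^-1).
  by apply/definable_funP; exact: dfun_inv.
pose K := N.+1%:R : R.
have e0 : 0 < (2 * K)^-1 :> R by rewrite invr_gt0 mulr_gt0 // ltr0n.
have /near0P[d d0 dslow] := slow _ e0.
have [y [y2 yd GN]] : exists y, [/\ 2 < y, d^-1 < y & (G y)^-1 <= y ^+ N.+1].
  suff /filter_ex : \forall y \near +oo, [/\ 2 < y, d^-1 < y & (G y)^-1 <= y ^+ N.+1] by [].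
  near=> y.
  have y2 : 2 < y by near: y; exact: nbhs_pinfty_gt.
  split => //; first by near: y; apply: nbhs_pinfty_gt; rewrite num_real.
  have y1 : 1 <= y by lra.
  apply: le_trans (ler_norm _) _; apply: (@le_trans _ _ (y ^+ N)).
    exact: (near FN y).
  by rewrite exprS ler_peMl // exprn_ge0 // (le_trans ler01).
have y1 : 1 < y by lra.
have y0 : 0 < y by lra.
have yK0 : 0 < y ^+ N.+1 by rewrite exprn_gt0.
have [e [_ eD] ve] := sup_adherent (divr_gt0 (G0 y) (ltr0n _ 2)) (supD y).
(* Half of the lower bound on G y, so that t < e although e is only known to
   exceed half of the supremum G y. *)
pose t := (2 * y ^+ N.+1)^-1.
have t0 : 0 < t by rewrite invr_gt0 mulr_gt0.
have GK : (y ^+ N.+1)^-1 <= G y by rewrite -[leRHS]invrK lef_pV2 // posrE invr_gt0.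
have te : t < e.
  apply: le_lt_trans ve; rewrite -/(G y) /t invfM; lra.
have ygt : y <= g t by apply: eD; rewrite t0.
have yyK : y <= y ^+ N.+1 by rewrite exprS ler_peMr ?exprn_ege1 // ltW.
have td : t < d.
  rewrite -[ltRHS]invrK ltf_pV2 ?posrE ?invr_gt0 ?mulr_gt0 //; lra.
have yt : y <= t `^ (- (2 * K)^-1).
  by apply: le_trans ygt (dslow _ _); rewrite t0.
have : y ^+ (2 * N.+1) <= t^-1.
  rewrite -(powR_inv1 (ltW t0)).
  have -> : t `^ (-1) = (t `^ (- (2 * K)^-1)) ^+ (2 * N.+1).
    rewrite -powR_mulrn ?powR_ge0 // -powRrM natrM mulNr mulVf //.
    by rewrite mulf_neq0 // pnatr_eq0.
  by rewrite lerXn2r // nnegrE ?powR_ge0 // ltW.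
rewrite invrK mulnC exprM expr2 ler_pM2r // => yK2; lra.
Unshelve. all: by end_near. Qed.

(** The exponent r is the supremum of the s with g <= t^s near 0. It exists
    because g and 1/g are polynomially bounded. For each e > 0 the dichotomy
    gives t^(r+e) <= g <= t^(r-e), so that [slow_bounded] applies to q = g / t^r
    and to 1/q. A bounded definable function has a limit, again by the
    dichotomy. *)
Lemma pos_asymptotics (g : R -> R) : dfun1 g -> (\forall t \near 0^'+, 0 < g t) ->
  exists r, exists2 c, c != 0 & (fun t => g t / t `^ r) @ 0^'+ --> c.
Proof.
move=> dg g0.
pose S := [set s | \forall t \near 0^'+, g t <= t `^ s].
have [N1 gN1] := polynomially_bounded_at0 dg.
have [N2 gN2] := polynomially_bounded_at0 (f := fun t => (g t)^-1) (dfun_inv dg).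
have supS : has_sup S.
  split; first by exists (- N1%:R).
  exists N2%:R => s Ss.
  have [t t01 [gs [gt gN]]] := near0_ex (filterI Ss (filterI g0 gN2)).
  rewrite -(ler_powR_lt1 _ _ t01) (le_trans _ gs) //.
  have /andP[t0 _] := t01.
  by rewrite -[leRHS]invrK -[leLHS]invrK -powRN lef_pV2 // posrE ?powR_gt0 // invr_gt0.
pose r := sup S.
have gle e : 0 < e -> \forall t \near 0^'+, g t <= t `^ (r - e).
  move=> e0; have [s Ss rs] := sup_adherent e0 supS.
  apply: filterS2 Ss (near0_01 R) => t gs t01; apply: le_trans gs _.
  by rewrite ler_powR_lt1 // ltW.
have pos_powerE (t s : R) : 0 < t -> pos_power s t = t `^ s by rewrite /pos_power => ->.
have gge e : 0 < e -> \forall t \near 0^'+, t `^ (r + e) <= g t.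
  move=> e0; have [gr|gr] := near0_le_dichotomy (g := pos_power (r + e)) dg (dpow (r + e)).
    have : S (r + e).
      by apply: filterS2 gr (near0_01 R) => t gr /andP[t0 _]; rewrite -pos_powerE.
    by move/(sup_upper_bound supS); rewrite -/r gerDl leNgt e0.
  by apply: filterS2 gr (near0_01 R) => t gr /andP[t0 _]; rewrite -pos_powerE // ltW.
pose q t := g t * pos_power (- r) t.
have dq : dfun1 q by apply: dfun_mul.
have q0 : \forall t \near 0^'+, 0 < q t.
  apply: filterS2 g0 (near0_01 R) => t gt0 /andP[t0 _].
  by rewrite mulr_gt0 // pos_powerE // powR_gt0.
have [C1 C10 qC1] : exists2 C, 0 < C & \forall t \near 0^'+, q t <= C.
  apply: (slow_bounded dq) => e e0.
  apply: filterS2 (gle e e0) (near0_01 R) => t gt /andP[t0 _].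
  rewrite /q pos_powerE // powRN ler_pdivrMr ?powR_gt0 // -powRD ?(gt_eqF t0) ?implybT //.
  by rewrite addrC.
have [C2 C20 qC2] : exists2 C, 0 < C & \forall t \near 0^'+, (q t)^-1 <= C.
  apply: (slow_bounded (g := fun t => (q t)^-1)) => [|e e0]; first exact: dfun_inv.
  apply: filterS3 (gge e e0) (near0_01 R) q0 => t gt /andP[t0 _] qt0.
  rewrite powRN lef_pV2 ?posrE ?powR_gt0 //.
  rewrite /q pos_powerE // powRN ler_pdivlMr ?powR_gt0 // -powRD ?(gt_eqF t0) ?implybT //.
  by rewrite addrC.
pose B := [set a | \forall t \near 0^'+, a <= q t].
have BC2 : B C2^-1.
  apply: filterS2 qC2 q0 => t qt qt0.
  by rewrite -[leRHS]invrK lef_pV2 // posrE invr_gt0.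
have supB : has_sup B.
  split; first by exists C2^-1.
  exists C1 => a Ba.
  have aC : \forall t \near (0 : R)^'+, a <= q t <= C1.
    by apply: filterS2 Ba qC1 => t -> ->.
  have [t _ /andP[at1 tC]] := near0_ex aC.
  exact: le_trans at1 tC.
pose c := sup B.
have c0 : 0 < c.
  by apply: (@lt_le_trans _ _ C2^-1); [rewrite invr_gt0|exact: sup_upper_bound].
exists r, c; first by rewrite gt_eqF.
have qc : q t @[t --> 0^'+] --> c.
  apply/cvgrPdist_lt => e e0.
  have [a Ba ca] := sup_adherent e0 supB.
  have qe : \forall t \near 0^'+, q t < c + e / 2.
    have [qce|//] := near0_le_dichotomy (f := fun=> c + e / 2) (dfun_cst MF 1 _) dq.
    by have := sup_upper_bound supB qce; rewrite -/c; lra.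
  apply: filterS2 Ba qe => t aq qe.
  move: ca; rewrite -/c => ca.
  rewrite ltr_distlC; apply/andP; split; lra.
apply: cvg_trans qc; apply: near_eq_cvg.
apply: filterS (near0_01 R) => t /andP[t0 _].
by rewrite /q pos_powerE // powRN.
Unshelve. all: by end_near. Qed.

End Asymptotics.

Lemma ln_asymptotics (R : realType) (f : R -> R) (r c : R) : c != 0 ->
  (\forall t \near 0^'+, 0 < f t) ->
  (fun t => f t / t `^ r) @ 0^'+ --> c ->
  (fun t => ln (f t) / ln t^-1) @ 0^'+ --> - r.
Proof.
move=> cn0 f0 fc.
have c0 : 0 < c.
  rewrite lt_neqAle eq_sym cn0 /= -(cvg_lim _ fc) //.
  apply: limr_ge; first by apply/cvg_ex; exists c.
  apply: filterS2 f0 (near0_01 R) => t ft /andP[t0 _].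
  by rewrite divr_ge0 ?powR_ge0 // ltW.
have lnV0 : (ln t^-1)^-1 @[t --> (0 : R)^'+] --> 0.
  have H : ln t^-1 @[t --> (0 : R)^'+] --> +oo.
    apply/cvgNrNy; apply: cvg_trans (@lnNy R); apply: near_eq_cvg.
    by apply: filterS (near0_01 R) => t /andP[t0 _]; rewrite !fctE lnV ?posrE // opprK.
  apply/gtr0_cvgV0 => //; apply: filterS (near0_01 R) => t /andP[t0 t1].
  by rewrite ln_gt0 // invf_gt1.
have lnc : ln (f t / t `^ r) / ln t^-1 - r @[t --> 0^'+] --> ln c * 0 - r.
  apply: cvgB; last exact: cvg_cst.
  apply: cvgM; last exact: lnV0.
  exact: (continuous_cvg _ (continuous_ln c0) fc).
rewrite mulr0 sub0r in lnc; apply: cvg_trans lnc; apply: near_eq_cvg.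
apply: filterS2 f0 (near0_01 R) => t ft /andP[t0 t1].
have l0 : ln t < 0 by rewrite ln_lt0 // t0.
rewrite ln_div ?posrE ?powR_gt0 // ln_powR lnV ?posrE //.
by field; rewrite lt_eqF.
Qed.

(** * Logarithmic limit sets and amoebas over Hardy fields *)

Section LogLimitSet.
Variables (R : realType) (n : nat).
Implicit Types (V : set 'rV[R]_n) (y : 'rV[R]_n).

Lemma closure_rowP (S : set 'rV[R]_n) y : closure S y <->
  forall e, 0 < e -> exists2 z, S z & forall i, `|y ord0 i - z ord0 i| < e.
Proof.
split=> [Sy e e0|H B /nbhs_ballP[e /= e0 eB]].
  have [z [Sz yz]] := Sy _ (nbhsx_ballx y e e0).
  by exists z => // i; have [_] := yz; apply.
have [z Sz yz] := H e e0; exists z; split => //.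
by apply: eB; split=> // i j; rewrite (ord1 i); exact: yz.
Qed.

Lemma log_limit_setP V y : log_limit_set V y <-> forall e, 0 < e ->
  exists2 t, 0 < t < e & exists2 x, V x &
    forall i, `|ln (x ord0 i) / ln t^-1 - y ord0 i| < e.
Proof.
split=> [Vy e e0|H B /nbhs_ballP[e /= e0 eB]].
  have m0 : 0 < Num.min e 1 by rewrite lt_min e0 ltr01.
  have [[z t] [[/= /andP[t0 t1] [x Vx xz]] [/= yz te]]] := Vy _ (nbhsx_ballx (y, 0) e e0).
  exists t.
    by move: te; rewrite /ball /= sub0r normrN gtr0_norm // t0 => ->.
  exists x => // i; have := yz.2 ord0 i.
  by rewrite -xz mxE /ball /= distrC.
have m0 : 0 < Num.min e 1 by rewrite lt_min e0 ltr01.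
have [t /andP[t0 tm] [x Vx xy]] := H _ m0.
move: tm; rewrite lt_min => /andP[te t1].
exists (Log_base t^-1 x, t); split => /=.
  by split; [rewrite t0|exists x].
apply: eB; split => /=; last by rewrite /ball /= sub0r normrN gtr0_norm.
split=> // i j; rewrite (ord1 i) mxE /ball /= distrC.
by apply: lt_le_trans (xy j) _; rewrite ge_min lexx.
Qed.

Lemma closure_log_limit_set V : closure (log_limit_set V) = log_limit_set V.
Proof.
apply/seteqP; split; last exact: subset_closure.
move=> y /closure_rowP Vy; apply/log_limit_setP => e e0.
have e2 : 0 < e / 2 by rewrite divr_gt0.
have [z /log_limit_setP/(_ _ e2)[t /andP[t0 te] [x Vx xz]] yz] := Vy _ e2.
exists t; first by rewrite t0; lra.
exists x => // i; have := xz i; have := yz i.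
rewrite !ltr_distl => /andP[h1 h2] /andP[h3 h4].
by apply/andP; split; lra.
Qed.

End LogLimitSet.

Section HardyAmoeba.
Variables (R : realType) (L : language) (M : structure L R).
Hypothesis omin : o_minimal M.
Local Notation MF := (over_field M).

(** By [los], whichever formula defines V, its extension consists of the germs
    of curves that eventually lie in V. *)
Lemma hardy_extensionP n (V : set 'rV[R]_n) h : definable M V ->
  hardy_extension omin V h <->
  \forall t \near 0^'+, V (\row_i repr (h ord0 i : germ M) t).
Proof.
have E (phi : formula (field_language L) R n) : defined_set MF id phi = V ->
    (\forall t \near 0^'+, V (\row_i repr (h ord0 i : germ M) t)) <->
    sat (germ_structure M) (@germ_cst R L M) phi (h ord0).
  move=> <-; rewrite (los omin) /defined_set /=.
  split; apply: filterS => t;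
    by rewrite (_ : (\row_i _) ord0 = fun i => repr (h ord0 i : germ M) t) //;
       apply: funext => i; rewrite mxE.
move=> [phi phiV]; split=> [[psi psiV]|/(E phi phiV)]; last by exists phi.
by move=> /(E psi psiV).
Qed.

Hypothesis asympt : forall g : pos_fun M, (\forall t \near 0^'+, 0 < g t) ->
  exists r, exists2 c, c != 0 & (fun t => g t / t `^ r) @ 0^'+ --> c.

Lemma germ_valuation_asymptotics (h : germ M) : (\forall t \near 0^'+, 0 < repr h t) ->
  exists2 c, c != 0 & (fun t => repr h t / t `^ germ_valuation h) @ 0^'+ --> c.
Proof.
move=> /asympt ex; exact: (@getPex _ [set r : R | exists2 c : R, c != 0 &
  (fun t => repr h t / t `^ r) @ 0^'+ --> c] ex).
Qed.

Lemma germ_valuation_ln (h : germ M) : (\forall t \near 0^'+, 0 < repr h t) ->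
  (fun t => ln (repr h t) / ln t^-1) @ 0^'+ --> - germ_valuation h.
Proof.
by move=> h0; have [c c0] := germ_valuation_asymptotics h0; exact: ln_asymptotics.
Qed.

(** The substitution x = 1/t turns an exponent at 0 into its opposite at
    +oo, where the field of exponents is defined. *)
Lemma germ_valuation_exponent (h : germ M) : (\forall t \near 0^'+, 0 < repr h t) ->
  field_of_exponents M (- germ_valuation h).
Proof.
move=> h0; have [c c0 hc] := germ_valuation_asymptotics h0.
pose H t := if 0 < t then repr h t else 0.
have dH : dfun MF (fun e : 'I_1 -> R => H (e ord0)) by exact: pos_fun_dfun.
exists (fun x => H x^-1).
  by apply/definable_funP/(dfun_comp1 dH)/dfun_inv; exact: dfun_var.
exists c => //; apply/cvgrPdist_lt => e e0.
have /near0P[d d0 dP] : \forall t \near 0^'+,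
    `|c - repr h t / t `^ germ_valuation h| < e.
  by move/cvgrPdist_lt: hc; apply.
near=> x.
have xd : d^-1 < x by near: x; apply: nbhs_pinfty_gt; rewrite num_real.
have x0 : 0 < x by rewrite (lt_trans _ xd) // invr_gt0.
have := dP x^-1; rewrite /H invr_gt0 x0.
have -> : (x^-1) `^ germ_valuation h = x `^ (- germ_valuation h).
  by rewrite -powR_inv1 ?(ltW x0) // -powRrM mulN1r.
by apply; rewrite -[ltRHS]invrK ltf_pV2 // posrE invr_gt0.
Unshelve. all: by end_near. Qed.

Section Definable.
Variables (n : nat) (V : set 'rV[R]_n).
Hypothesis Vpos : V `<=` [set x : 'rV[R]_n | forall i, 0 < x ord0 i].
Hypothesis Vdef : definable M V.

Lemma hardy_extension_pos h i : hardy_extension omin V h ->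
  \forall t \near 0^'+, 0 < repr (h ord0 i : germ M) t.
Proof.
move=> /hardy_extensionP => /(_ Vdef); apply: filterS => t /Vpos /(_ i).
by rewrite /= mxE.
Qed.

Lemma val_Log_sub_log_limit_set : val_Log (hardy_valuation omin) (hardy_extension omin V)
  `<=` log_limit_set V.
Proof.
move=> _ [h hV <-]; apply/log_limit_setP => e e0.
have hlog : \forall t \near 0^'+, forall i,
    `|ln (repr (h ord0 i : germ M) t) / ln t^-1 - - germ_valuation (h ord0 i)| < e.
  apply: filter_forall => i.
  move/cvgrPdist_lt: (germ_valuation_ln (hardy_extension_pos i hV)) => /(_ e e0).
  by apply: filterS => t; rewrite distrC.
have te : \forall t \near (0 : R)^'+, t < e by exact: nbhs_right_lt.
have [t /andP[t0 _] [hVt [hlogt te']]] :=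
  near0_ex (filterI ((hardy_extensionP h Vdef).1 hV) (filterI hlog te)).
exists t; first by rewrite t0.
exists (\row_i repr (h ord0 i : germ M) t) => // i.
by rewrite !mxE.
Qed.

Lemma curve_selection_in (C : R -> ('I_n -> R) -> Prop) :
  dpred MF (fun e : 'I_n.+1 -> R => C (e ord0) (fun i => e (lift ord0 i))) ->
  (forall d, 0 < d -> exists2 t, 0 < t < d & exists2 x, V x & C t (x ord0)) ->
  exists2 h, hardy_extension omin V h &
    \forall t \near 0^'+, C t (fun i => repr (h ord0 i : germ M) t).
Proof.
move=> dC freqC.
have dV : dpred MF (fun e : 'I_n.+1 -> R => V (\row_i e (lift ord0 i))).
  have /definableP dV := Vdef.
  exact: (dpred_rename (lift ord0) dV).
have [d d0|h hP] := curve_selection omin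
  (P := fun t x => V (\row_i x i) /\ C t x) (dpred_and dV dC).
  have [t td [x Vx Cx]] := freqC d d0; exists t => //; exists (x ord0).
  by split=> //; rewrite (_ : \row_i _ = x) //; apply/rowP => i; rewrite mxE.
have hE t : (fun i => repr ((\row_i h i) ord0 i : germ M) t) = (fun i => repr (h i) t).
  by apply: funext => i; rewrite mxE.
exists (\row_i h i).
  apply/(hardy_extensionP _ Vdef); apply: filterS hP => t [Vt _].
  by move: Vt; congr V; apply/rowP => i; rewrite !mxE.
by apply: filterS hP => t [_]; rewrite hE.
Qed.

(** Integral powers are definable in every expansion of the real field, which
    allows to prescribe valuations up to an error 3/N: an error 2 in the exponent
    of t, and 1 from the integral part of [N * y_i], both divided by N. *)
Lemma log_limit_set_sub_closure : log_limit_set V `<=`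
  closure (val_Log (hardy_valuation omin) (hardy_extension omin V)).
Proof.
move=> y /log_limit_setP Vy; apply/closure_rowP => e e0.
(* 3 < N * e bounds the sum of the two errors. *)
pose N := (Num.truncn (3 / e)).+1.
have N0 : 0 < N%:R :> R by rewrite ltr0n.
have Ne : 3 / e < N%:R by exact: truncnS_gt.
have Ne' : 3 < N%:R * e by rewrite -ltr_pdivrMr.
pose k i := Num.floor (N%:R * y ord0 i).
have kP i : (k i)%:~R <= N%:R * y ord0 i < (k i)%:~R + 1.
  by rewrite -intrD1 floor_itv // num_real.
pose C t (x : 'I_n -> R) := forall i,
  t ^ (2 : int) <= x i ^+ N * t ^ k i /\ x i ^+ N * t ^ k i <= t ^ (- 2 : int).
have lnC t x : 0 < t < 1 -> 0 < x -> forall i,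
   (t ^ (2 : int) <= x ^+ N * t ^ k i /\ x ^+ N * t ^ k i <= t ^ (- 2 : int)) <->
   `|N%:R * (ln x / ln t^-1) - (k i)%:~R| <= 2.
  move=> /andP[t0 t1] x0 i.
  have l0 : 0 < ln t^-1 by rewrite ln_gt0 // invf_gt1.
  have lnE z : ln (t ^ z) = - z%:~R * ln t^-1.
    by rewrite -powR_intmul ?(ltW t0) // ln_powR lnV ?posrE // mulrNN.
  have lnxE : ln (x ^+ N * t ^ k i) = (N%:R * (ln x / ln t^-1) - (k i)%:~R) * ln t^-1.
    rewrite lnM ?posrE ?exprn_gt0 ?exprz_gt0 // lnXn // lnE -mulr_natl.
    by field; rewrite gt_eqF.
  have p0 : 0 < x ^+ N * t ^ k i by rewrite mulr_gt0 ?exprn_gt0 ?exprz_gt0.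
  rewrite -(ler_ln (x := t ^ 2)) ?posrE ?exprz_gt0 //.
  rewrite -(ler_ln (y := t ^ (-2))) ?posrE ?exprz_gt0 //.
  rewrite lnxE !lnE !ler_pM2r // ler_norml.
  by rewrite rmorphN opprK; split=> [[-> ->]//|/andP].
have [||h hV hC] := @curve_selection_in C.
- have dt : dfun MF (fun e : 'I_n.+1 -> R => e ord0) by exact: dfun_var.
  apply: (dpred_finall 0) => i.
  have dx : dfun MF (fun e : 'I_n.+1 -> R => e (lift ord0 i) ^+ N * e ord0 ^ k i).
    by apply: dfun_mul; [apply: dfun_exp; exact: dfun_var|exact: dfun_exprz].
  by apply: dpred_and; apply: dpred_le => //; exact: dfun_exprz.
- move=> d d0.
  have m0 : 0 < Num.min d (Num.min 1 N%:R^-1) by rewrite !lt_min d0 ltr01 invr_gt0.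
  have [t /andP[t0]] := Vy _ m0; rewrite !lt_min => /and3P[td t1 _] [x Vx xy].
  exists t; first by rewrite t0.
  exists x => // i; apply/lnC; [by rewrite t0|exact: Vpos|].
  have := xy i; rewrite !lt_min => /and3P[_ _].
  move: (kP i) => /andP[k1 k2].
  rewrite -(ltr_pM2l N0) mulfV ?gt_eqF // -{1}(gtr0_norm N0) -normrM mulrBr.
  rewrite ltr_distl ler_distl => /andP[h1 h2].
  by apply/andP; split; lra.
exists (\row_i - germ_valuation (h ord0 i)); first by exists h.
move=> i; rewrite mxE.
have hi0 := hardy_extension_pos i hV.
have lim := germ_valuation_ln hi0.
have limN : `|N%:R * ln (repr (h ord0 i : germ M) t) / ln t^-1 - (k i)%:~R|
    @[t --> 0^'+] --> `|N%:R * - germ_valuation (h ord0 i) - (k i)%:~R|.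
  apply: cvg_norm; apply: cvgB; last exact: cvg_cst.
  under eq_fun do rewrite -mulrA.
  by apply: cvgM => //; exact: cvg_cst.
have : `|N%:R * - germ_valuation (h ord0 i) - (k i)%:~R| <= 2.
  rewrite -(cvg_lim _ limN) //; apply: limr_le; first by apply/cvg_ex; eexists; exact: limN.
  apply: filterS3 hC hi0 (near0_01 R) => t hC hi t01.
  by rewrite -mulrA; apply/lnC.
rewrite ler_distl => /andP[h1 h2]; have /andP[k1 k2] := kP i.
rewrite -(ltr_pM2l N0) -{1}(gtr0_norm N0) -normrM mulrBr ltr_distl.
by apply/andP; split; lra.
Qed.

End Definable.
End HardyAmoeba.

(** * Attaining the whole logarithmic limit set with real powers *)

Section Regular.
Variables (R : realType) (L : language) (M : structure L R).
Local Notation MR := (power_expansion M).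
Local Notation MF := (over_field MR).
Hypothesis omin : o_minimal MR.
Hypothesis pbMR : polynomially_bounded MR.

Let dpow r : dfun MF (fun e : 'I_1 -> R => pos_power r (e ord0)).
Proof. by apply: dfun_pos_power; exact: dfun_var. Qed.

Lemma power_expansion_asymptotics (g : R -> R) :
  dfun MF (fun e : 'I_1 -> R => if 0 < e ord0 then g (e ord0) else 0) ->
  (\forall t \near 0^'+, 0 < g t) ->
  exists r, exists2 c, c != 0 & (fun t => g t / t `^ r) @ 0^'+ --> c.
Proof.
move=> dg g0.
have [|r [c c0 gc]] := pos_asymptotics omin pbMR dpow
  (g := fun t => if 0 < t then g t else 0) dg.
  by apply: filterS2 g0 (near0_01 R) => t gt /andP[-> _].
exists r, c => //; apply: cvg_trans gc; apply: near_eq_cvg.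
by apply: filterS (near0_01 R) => t /andP[-> _].
Qed.

Lemma asymptotics_power_expansion (g : pos_fun MR) : (\forall t \near 0^'+, 0 < g t) ->
  exists r, exists2 c, c != 0 & (fun t => g t / t `^ r) @ 0^'+ --> c.
Proof. by apply: power_expansion_asymptotics; exact: pos_fun_dfun. Qed.

Lemma asymptotics_reduct (g : pos_fun M) : (\forall t \near 0^'+, 0 < g t) ->
  exists r, exists2 c, c != 0 & (fun t => g t / t `^ r) @ 0^'+ --> c.
Proof.
apply: power_expansion_asymptotics; apply: dpred_power_expansion.
exact: pos_fun_dfun.
Qed.

Lemma definable_power_expansion n (V : set 'rV[R]_n) : definable M V -> definable MR V.
Proof. by move=> /definableP/dpred_power_expansion dV; apply/definableP. Qed.

Section LogLimit.
Variables (n : nat) (V : set 'rV[R]_n).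
Hypothesis Vpos : V `<=` [set x : 'rV[R]_n | forall i, 0 < x ord0 i].
Hypothesis Vdef : definable MR V.

(** In logarithmic coordinates of base 1/t, this is the cube of center y and
    radius ln (1/u) / ln (1/t), by [within_factor_ln]; as t tends to 0 with u
    fixed, it shrinks to y. *)
Definition within_factor (y : 'rV[R]_n) u t (x : 'I_n -> R) :=
  forall i, u <= x i * pos_power (y ord0 i) t /\ x i * pos_power (y ord0 i) t <= u^-1.

Lemma dpred_within_factor y m (u t : ('I_m -> R) -> R) (x : 'I_n -> ('I_m -> R) -> R) :
  dfun MF u -> dfun MF t -> (forall i, dfun MF (x i)) ->
  dpred MF (fun e => within_factor y (u e) (t e) (fun i => x i e)).
Proof.
move=> du dt dx; apply: (dpred_finall 0) => i.
have dxy : dfun MF (fun e => x i e * pos_power (y ord0 i) (t e)).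
  by apply: dfun_mul => //; exact: dfun_pos_power.
by apply: dpred_and; apply: dpred_le => //; exact: dfun_inv.
Qed.

Lemma within_factor_ln y u t x : 0 < u -> 0 < t < 1 -> (forall i, 0 < x i) ->
  within_factor y u t x <->
  forall i, `|ln (x i) / ln t^-1 - y ord0 i| <= ln u^-1 / ln t^-1.
Proof.
move=> u0 /andP[t0 t1] x0.
have l0 : 0 < ln t^-1 by rewrite ln_gt0 // invf_gt1.
suff E i : (u <= x i * pos_power (y ord0 i) t /\ x i * pos_power (y ord0 i) t <= u^-1) <->
    `|ln (x i) / ln t^-1 - y ord0 i| <= ln u^-1 / ln t^-1.
  by split=> h i; apply/E.
have p0 : 0 < t `^ y ord0 i by rewrite powR_gt0.
have lnE : ln (x i * t `^ y ord0 i) = (ln (x i) / ln t^-1 - y ord0 i) * ln t^-1.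
  rewrite lnM ?posrE // ln_powR lnV ?posrE //; field.
  by move: l0; rewrite lnV ?posrE // oppr_gt0 => /lt_eqF ->.
rewrite /pos_power t0 ler_pdivlMr // -{2}(gtr0_norm l0) -normrM -lnE ler_norml.
rewrite -(ler_ln (x := u)) ?posrE ?mulr_gt0 //.
rewrite -(ler_ln (y := u^-1)) ?posrE ?mulr_gt0 ?invr_gt0 //.
by rewrite lnV ?posrE // opprK; split=> [[-> ->]//|/andP].
Qed.

(** The largest u for which V meets [within_factor y u t] defines a function
    k of t. The hypothesis on y makes 1/k grow more slowly than any negative
    power of t, so [slow_bounded] bounds it: a fixed u0 works for all small t, and
    the curve selected with this u0 has valuation exactly -y. *)
Lemma log_limit_set_sub_val_Log :
  log_limit_set V `<=` val_Log (hardy_valuation omin) (hardy_extension omin V).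
Proof.
move=> y Vy.
pose X u t := exists2 x, V x & within_factor y u t (x ord0).
have dX m (u t : ('I_m -> R) -> R) : dfun MF u -> dfun MF t ->
    dpred MF (fun e => X (u e) (t e)).
  move=> du dt.
  have dX' : dpred MF (fun e => exists x : 'I_n -> R,
      V (\row_i x i) /\ within_factor y (u e) (t e) x).
    apply: dpred_exs; apply: dpred_and.
      have /definableP dV := Vdef.
      exact: (dpred_rename (lshift m) dV).
    apply: dpred_within_factor => [||i]; last exact: dfun_var.
      by apply: (dfun_subst 0 du) => i; exact: dfun_var.
    by apply: (dfun_subst 0 dt) => i; exact: dfun_var.
  apply: dpred_ext dX' => e; split=> [[x [Vx xu]]|[x Vx xu]].
    exists (\row_i x i) => //.
    by move: xu; congr within_factor; apply: funext => i; rewrite mxE.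
  exists (x ord0); split=> //.
  by rewrite (_ : \row_i _ = x) //; apply/rowP => i; rewrite mxE.
have nearX e : 0 < e -> \forall t \near 0^'+, X (t `^ e) t.
  move=> e0.
  have dXe : dpred MF (fun a : 'I_1 -> R => X (pos_power e (a ord0)) (a ord0)).
    by apply: dX; [exact: dpow|exact: dfun_var].
  have [nX|/near0P[d d0 nX]] :=
    @ominimal_dichotomy _ _ _ omin (fun t => X (pos_power e t) t) dXe.
    apply: filterS2 nX (near0_01 R) => t; rewrite /pos_power => Xt /andP[t0 _].
    by rewrite t0 in Xt.
  have m0 : 0 < Num.min e (Num.min 1 d) by rewrite !lt_min e0 ltr01.
  have [t /andP[t0]] := (log_limit_setP V y).1 Vy _ m0.
  rewrite !lt_min => /and3P[te t1 td] [x Vx xy].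
  have [] := nX t; first by rewrite t0.
  exists x => //; rewrite /pos_power t0; apply/within_factor_ln.
  - exact: powR_gt0.
  - by rewrite t0.
  - exact: Vpos.
  move=> i; have := xy i; rewrite !lt_min => /andP[/ltW xe _].
  have l0 : 0 < ln t^-1 by rewrite ln_gt0 // invf_gt1.
  by rewrite -powRN ln_powR mulNr -mulrN -lnV ?posrE // mulfK // gt_eqF.
pose K t := [set u | (0 < u /\ u <= 1) /\ X u t].
pose k t := sup (K t).
have dk : dfun MF (fun e : 'I_1 -> R => k (e ord0)).
  apply: (@dfun_sup _ _ MR 1 (fun u e => (0 < u /\ u <= 1) /\ X u (e ord0))).
  have d0 := dfun_var MF (ord0 : 'I_2).
  apply: dpred_and; last by apply: dX => //; exact: dfun_var.
  by apply: dpred_and; [apply: dpred_lt|apply: dpred_le] => //; exact: dfun_cst.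
have ub1 t : ubound (K t) 1 by move=> u [[]].
have kge e : 0 < e -> \forall t \near 0^'+, has_sup (K t) /\ t `^ e <= k t.
  move=> e0; apply: filterS2 (nearX e e0) (near0_01 R) => t Xt /andP[t0 t1].
  have Kt : K t (t `^ e).
    split=> //; split; first exact: powR_gt0.
    by rewrite -(powRr0 t) ler_powR_lt1 ?t0 // ltW.
  have supK : has_sup (K t) by split; [exists (t `^ e)|exists 1].
  by split=> //; exact: sup_upper_bound.
have [C C0 kC] : exists2 C, 0 < C & \forall t \near 0^'+, (k t)^-1 <= C.
  apply: (slow_bounded omin pbMR (g := fun t => (k t)^-1)) => [|e e0].
    exact: dfun_inv.
  apply: filterS2 (kge e e0) (near0_01 R) => t [_ kt] /andP[t0 _].
  have p0 : 0 < t `^ e by rewrite powR_gt0.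
  by rewrite powRN lef_pV2 // posrE // (lt_le_trans p0).
(* The supremum k t >= 1/C may not be attained, but 1/(2C) is exceeded. *)
pose u0 := (2 * C)^-1.
have u00 : 0 < u0 by rewrite invr_gt0 mulr_gt0.
have nearXu : \forall t \near 0^'+, X u0 t.
  apply: filterS3 (kge 1 ltr01) kC (near0_01 R) => t [supK kt] ktC /andP[t0 _].
  have k0 : 0 < k t by rewrite (lt_le_trans _ kt) // powR_gt0.
  have [u [[u0' _] [x Vx xu]] ku] := sup_adherent (divr_gt0 k0 (ltr0n _ 2)) supK.
  have uu : u0 <= u.
    apply: le_trans (ltW ku); rewrite -/(k t) /u0 invfM.
    have : C^-1 <= k t by rewrite -[leRHS]invrK lef_pV2 // posrE invr_gt0.
    lra.
  exists x => // i; have [h1 h2] := xu i; split; first exact: le_trans uu h1.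
  by apply: le_trans h2 _; rewrite lef_pV2.
have [||h hV hC] := curve_selection_in omin Vdef (C := within_factor y u0).
- by apply: dpred_within_factor => [||i]; [exact: dfun_cst|exact: dfun_var|exact: dfun_var].
- move=> d d0.
  have td : \forall t \near (0 : R)^'+, t < d by exact: nbhs_right_lt.
  have [t /andP[t0 _] [Xt td']] := near0_ex (filterI nearXu td).
  by exists t; rewrite ?t0.
exists h => //; apply/rowP => i; rewrite mxE.
have h0 j := hardy_extension_pos Vpos Vdef j hV.
have lim := germ_valuation_ln asymptotics_power_expansion (h0 i).
suff limy : (fun t => ln (repr (h ord0 i : germ MR) t) / ln t^-1) @ 0^'+ --> y ord0 i.
  by rewrite -(cvg_lim _ limy) // -(cvg_lim _ lim).
apply/cvgrPdist_lt => e e0.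
have lnV0 : (fun t => ln u0^-1 / ln t^-1) @ (0 : R)^'+ --> 0.
  have := @ln_asymptotics R (fun=> u0^-1) 0 u0^-1.
  rewrite oppr0; apply.
  - by rewrite gt_eqF // invr_gt0.
  - by near=> t; rewrite invr_gt0.
  - by under eq_fun do rewrite powRr0 divr1; exact: cvg_cst.
move/cvgrPdist_lt: lnV0 => /(_ e e0) lnV0.
have h0' : \forall t \near 0^'+, forall j, 0 < repr (h ord0 j : germ MR) t.
  exact: filter_forall.
apply: filterS2 lnV0 (filterI (near0_01 R) (filterI hC h0')) => t lnt [t01 [hCt h0t]].
rewrite distrC; apply: le_lt_trans ((within_factor_ln y u00 t01 h0t).1 hCt i) _.
by move: lnt; rewrite sub0r normrN; apply: le_lt_trans; exact: ler_norm.
Unshelve. all: by end_near. Qed.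

End LogLimit.
End Regular.

Theorem corollary4p5 (R : realType) (L : language) (M : structure L R)
    (regM : regular M) (ominMR : o_minimal (power_expansion M))
    (n : nat) (V : set 'rV[R]_n)
    (Vpos : V `<=` [set x : 'rV[R]_n | forall i, 0 < x ord0 i])
    (Vdef : definable M V) :
  let V1 := hardy_extension (regular_o_minimal regM) V in
  let v1 := hardy_valuation (regular_o_minimal regM) in
  let V2 := hardy_extension ominMR V in
  let v2 := hardy_valuation ominMR in
  let Lambda := field_of_exponents M in
  [/\ log_limit_set V = val_Log v2 V2,
      log_limit_set V `<=`
        closure (log_limit_set V `&` [set y : 'rV[R]_n | forall i, Lambda (y ord0 i)]),
      nonarch_amoeba v1 V1 = nonarch_amoeba v2 V2
    & nonarch_amoeba v2 V2 = val_Log v2 V2].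
Proof.
move=> V1 v1 V2 v2 Lambda.
have pbMR : polynomially_bounded (power_expansion M) by have [] := regM.
have asym1 := @asymptotics_reduct _ _ _ ominMR pbMR.
have asym2 := @asymptotics_power_expansion _ _ _ ominMR pbMR.
have Vdef2 := definable_power_expansion Vdef.
have log1 : val_Log v1 V1 `<=` log_limit_set V by exact: val_Log_sub_log_limit_set.
have dense1 : log_limit_set V `<=` closure (val_Log v1 V1) by exact: log_limit_set_sub_closure.
have log2 : log_limit_set V = val_Log v2 V2.
  apply/seteqP; split; first exact: log_limit_set_sub_val_Log.
  exact: val_Log_sub_log_limit_set.
have cl2 : nonarch_amoeba v2 V2 = val_Log v2 V2.
  by rewrite /nonarch_amoeba -log2 closure_log_limit_set.
split=> //.
- apply: subset_trans dense1 _; apply: closureS => y y1; split; first exact: log1.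
  move: y1 => [h hV <-] i /=; rewrite mxE.
  apply: germ_valuation_exponent => //.
  exact: hardy_extension_pos hV.
- rewrite cl2 -log2 /nonarch_amoeba; apply/seteqP; split=> //.
  by rewrite -closure_log_limit_set; exact: closureS.
Qed.
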